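(* Let $\mathbf{V}$ be a nonzero matricially normed space and, for each $n\in\mathbb{N}$, let $M_n(\mathbf{V})_+$ be a cone in $M_n(\mathbf{V})$. Then there exist a Hilbert space $H$ and a complete isometry $\Phi:\mathbf{V}\to\mathcal{L}(H)$ with $\Phi_n(M_n(\mathbf{V})_+)=\Phi_n(M_n(\mathbf{V}))\cap\mathcal{L}(H^n)_+$ for all $n\in\mathbb{N}$ if and only if $n^+_{\mathrm{cb}}(\mathbf{V})=1$ and $M_n(\mathbf{V})_+=\mathbf{K}_n$ for every $n\in\mathbb{N}$.
   Context: All vector spaces are complex. $M_{m,n}$ is the space of complex $m\times n$ matrices with the operator norm and $M_n=M_{n,n}$, with $(M_n)_+$ the positive semidefinite matrices. A matricially normed space $\mathbf{V}$ is a vector space with a norm on each $M_k(\mathbf{V})$ ($k\in\mathbb{N}$) such that $\|\alpha x\beta\|\le\|\alpha\|\|x\|\|\beta\|$ for all $x\in M_m(\mathbf{V})$, $\alpha\in M_{n,m}$, $\beta\in M_{m,n}$. A cone is a subset containing $0$ and closed under addition and multiplication by nonnegative reals. For Hilbert space $H$, $M_k(\mathcal{L}(H))=\mathcal{L}(H^k)$, and $\mathcal{L}(H^k)_+$ is the cone of positive operators. For linear $\varphi:\mathbf{V}\to\mathbf{W}$, $\varphi_k:M_k(\mathbf{V})\to M_k(\mathbf{W})$ denotes entrywise application, $\|\varphi\|_{\mathrm{cb}}=\sup_k\|\varphi_k\|$, and $\mathrm{CB}(\mathbf{V},\mathbf{W})$ is the set of $\varphi$ with $\|\varphi\|_{\mathrm{cb}}<\infty$;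 $\varphi$ is a complete isometry if every $\varphi_k$ is isometric. Given the cones $M_n(\mathbf{V})_+$, put $\mathcal{S}^+_n(\mathbf{V})=\{\varphi\in\mathrm{CB}(\mathbf{V},M_n):\|\varphi\|_{\mathrm{cb}}\le1,\ \varphi_m(M_m(\mathbf{V})_+)\subseteq(M_{mn})_+\text{ for all }m\in\mathbb{N}\}$, $\gamma^+_k(x)=\sup\{\|\varphi_k(x)\|:\varphi\in\mathcal{S}^+_n(\mathbf{V}),\ n\in\mathbb{N}\}$ for $x\in M_k(\mathbf{V})$, $n^+_{\mathrm{cb}}(\mathbf{V})=\inf\{\gamma^+_k(x):x\in M_k(\mathbf{V}),\ \|x\|=1,\ k\in\mathbb{N}\}$, and $\mathbf{K}_n=\{v\in M_n(\mathbf{V}):\varphi_n(v)\in(M_{nk})_+\text{ for all }k\in\mathbb{N}\text{ and all }\varphi\in\mathcal{S}^+_k(\mathbf{V})\}$. *)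

(* Defs.v *)
From mathcomp Require Import all_boot all_order all_algebra.
From mathcomp Require Import complex.
From mathcomp Require Import boolp classical_sets functions reals constructive_ereal ereal.
From mathcomp Require Import topology normedtype.

Set Implicit Arguments.
Unset Strict Implicit.
Unset Printing Implicit Defensive.

Import Order.TTheory GRing.Theory Num.Theory.
Import Num.Def numFieldNormedType.Exports.

Local Open Scope classical_set_scope.
Local Open Scope ring_scope.
Local Open Scope complex_scope.

(* Conventions. The complex field is R[i] for R : realType. Its order is the
   partial one: 0 <= z means that z is real and nonnegative. Matrix sizes in
   {1, 2, 3, ...} are written n.+1 with n : nat, so a family indexed by n : nat
   has its n-th member in size n.+1. Norms that could be infinite, and the
   suprema and infima built from them, take values in \bar R. *)

Section Norms.
Context {R : realType}.

(* The Hilbert-sum norm on W^n. It is not the norm of the library on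
   matrices, which is the maximum of the norms of the entries. *)
Definition l2norm (W : normedZmodType R[i]) n (x : 'cV[W]_n) : R :=
  Num.sqrt (\sum_(i < n) complex.Re `|x i 0| ^+ 2).

Definition opnorm (U W : Type) (normU : U -> R) (normW : W -> R) (f : U -> W) :
    \bar R :=
  ereal_sup [set (normW (f u))%:E | u in [set u | normU u <= 1]].

(* [fine] is harmless here: the supremum is finite for every matrix. *)
Definition mxnorm m n (A : 'M[R[i]]_(m, n)) : R :=
  fine (opnorm (@l2norm R[i] n) (@l2norm R[i] m) (mulmx A)).

(* Over the complex numbers, the condition forces A to be Hermitian. *)
Definition psdmx n : set 'M[R[i]]_n :=
  [set A | forall x : 'cV[R[i]]_n, 0 <= (map_mx conjC x^T *m (A *m x)) 0 0].

End Norms.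

Section HilbertSpaces.
Variable R : realType.

Record hilbertSpace := HilbertSpace {
  hilbert_sort :> completeNormedModType R[i];
  inner : {dot hilbert_sort for conjC};
  inner_norm : forall x : hilbert_sort, inner x x = `|x| ^+ 2 }.

Variable H : hilbertSpace.

(* The space L(H), as a set of functions. *)
Definition bounded_operators : set (H -> H) :=
  [set T | linear T /\ exists M : R[i], forall x, `|T x| <= M * `|x|].

(* The identification M_n(L(H)) = L(H^n): the operator with matrix T. *)
Definition mxop n (T : 'M[H -> H]_n) (x : 'cV[H]_n) : 'cV[H]_n :=
  \col_i \sum_(j < n) T i j (x j 0).

Definition mxop_norm n (T : 'M[H -> H]_n) : \bar R :=
  opnorm (@l2norm R H n) (@l2norm R H n) (mxop T).

Definition positive_operators n : set 'M[H -> H]_n :=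
  [set T : 'M[H -> H]_n | (forall i j, bounded_operators (T i j)) /\
           forall x : 'cV[H]_n, 0 <= \sum_(i < n) inner H (mxop T x i 0) (x i 0)].

End HilbertSpaces.

Section MatriciallyNormed.
Variable R : realType.
Variable V : lmodType R[i].

(* The product alpha x beta of scalar matrices with a matrix over V. *)
Definition mulmx3 m n p q (a : 'M[R[i]]_(n, m)) (x : 'M[V]_(m, p))
    (b : 'M[R[i]]_(p, q)) : 'M[V]_(n, q) :=
  \matrix_(i, j) \sum_(k < m) \sum_(l < p) (a i k * b l j) *: x k l.

Record matricial_norm (N : forall k, 'M[V]_k.+1 -> R) : Prop := MatricialNorm {
  matricial_norm_eq0 : forall k (x : 'M[V]_k.+1), N k x = 0 -> x = 0;
  matricial_normD : forall k (x y : 'M[V]_k.+1), N k (x + y) <= N k x + N k y;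
  matricial_normZ : forall k (a : R[i]) (x : 'M[V]_k.+1),
    N k (map_mx ( *:%R a) x) = complex.Re `|a| * N k x;
  matricial_normM : forall m n (a : 'M[R[i]]_(n.+1, m.+1)) (x : 'M[V]_m.+1)
      (b : 'M[R[i]]_(m.+1, n.+1)),
    N n (mulmx3 a x b) <= mxnorm a * N m x * mxnorm b }.

Definition is_cone n (K : set 'M[V]_n) : Prop :=
  [/\ K 0, forall x y, K x -> K y -> K (x + y) &
      forall (t : R) x, 0 <= t -> K x -> K (map_mx ( *:%R t%:C) x)].

(* phi_k, with M_k(M_n) identified with M_{kn} by means of block matrices;
   the size kn appears as \sum_(i < k) n. *)
Definition ampl n (phi : V -> 'M[R[i]]_n) k (x : 'M[V]_k) :
    'M[R[i]]_(\sum_(i < k) n, \sum_(j < k) n) :=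
  \mxblock_(i < k, j < k) phi (x i j).

Variable N : forall k, 'M[V]_k.+1 -> R.
Variable P : forall k, set 'M[V]_k.+1.

Definition cbnorm n (phi : V -> 'M[R[i]]_n) : \bar R :=
  ereal_sup [set opnorm (@N k) (@mxnorm R _ _) (@ampl n phi k.+1) | k in setT].

Definition pos_contractions n : set {linear V -> 'M[R[i]]_n.+1} :=
  [set phi | (cbnorm phi <= 1)%E /\
             forall m (x : 'M[V]_m.+1), P x -> psdmx (ampl phi x)].

Definition gammap k (x : 'M[V]_k.+1) : \bar R :=
  ereal_sup [set e | exists n (phi : {linear V -> 'M[R[i]]_n.+1}),
    pos_contractions phi /\ e = (mxnorm (ampl phi x))%:E].

Definition ncbp : \bar R :=
  ereal_inf [set e | exists k (x : 'M[V]_k.+1), N x = 1 /\ e = gammap x].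

Definition Kcone n : set 'M[V]_n.+1 :=
  [set v | forall k (phi : {linear V -> 'M[R[i]]_k.+1}),
    pos_contractions phi -> psdmx (ampl phi v)].

End MatriciallyNormed.

(* Main.v *)
(* Necessity: for a finite set of vectors in H^k, Gram-Schmidt gives a finite
   orthonormal system whose span contains all their coordinates; compressing Phi to
   this span gives an element of S^+_n that computes the norms and quadratic forms of
   Phi on these vectors. Hence gamma^+ dominates the norm, and an element of K_n is
   mapped to a positive operator. Sufficiency: the direct sum of all elements of all
   the S^+_n, acting on the Hilbert sum of the spaces C^n, has norm gamma^+ = ||.||
   and is positive exactly on the K_n. *)
From HB Require Import structures.
Require Import Defs.
From mathcomp Require Import all_boot all_order all_algebra.
From mathcomp Require Import complex.
From mathcomp Require Import boolp classical_sets functions reals constructive_ereal ereal.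
From mathcomp Require Import topology normedtype.
From mathcomp Require Import finmap cardinality fsbigop esum ring lra.

Set Implicit Arguments.
Unset Strict Implicit.
Unset Printing Implicit Defensive.

Import Order.TTheory GRing.Theory Num.Theory.
Import Num.Def numFieldNormedType.Exports.

Local Open Scope classical_set_scope.
Local Open Scope ring_scope.
Local Open Scope complex_scope.

(** The elements of [pos_contractions] take values in matrices of finite size, while [Phi] acts on
    an arbitrary Hilbert space. Passing from one to the other works because every condition involved
    is tested on finitely many vectors at a time: an operator norm is a supremum over single columns
    u, and positivity concerns the single numbers <Phi_k(x) u, u>. In the converse direction the
    direct sum is indexed by all such maps, with no countability available, so the Hilbert sum, its
    unconditional sums and its completeness are established over an arbitrary index set. The sum
    defines bounded operators because ||phi(v)|| <= ||v|| is one bound for all summands. Its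
    isometry has two halves of different origin: gamma^+ <= ||.|| is the contractivity of each
    summand, whereas n^+_cb = 1 speaks only of matrices of norm one and yields ||.|| <= gamma^+ by
    homogeneity. For necessity, V != 0 makes the infimum defining n^+_cb range over a nonempty
    set. *)

Section ComplexNumbers.
Context {R : realType}.
Local Notation C := R[i].

(** * Real-valued norms and real parts over the complex numbers *)

Lemma conjCE (z : C) : conjC z = conjc z. Proof. by []. Qed.

Lemma ReD (x y : C) : complex.Re (x + y) = complex.Re x + complex.Re y.
Proof. by case: x y => [? ?] [? ?]. Qed.

Lemma ImD (x y : C) : complex.Im (x + y) = complex.Im x + complex.Im y.
Proof. by case: x y => [? ?] [? ?]. Qed.

Lemma Re_real_mul (a : R) (x : C) : complex.Re (a%:C * x) = a * complex.Re x.
Proof. by case: x => ? ? /=; rewrite mul0r subr0. Qed.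

Lemma Re_ge0 (x : C) : 0 <= x -> 0 <= complex.Re x.
Proof. by rewrite lecE => /andP[_]. Qed.

Lemma ge0_RRe (x : C) : 0 <= x -> (complex.Re x)%:C = x.
Proof. by move=> /ger0_real; exact: RRe_real. Qed.

Lemma le_Re (x y : C) : x <= y -> complex.Re x <= complex.Re y.
Proof. by rewrite lecE => /andP[_]. Qed.

(* Norms over C take values in C; rnorm reads them in R. *)
Definition rnorm (W : normedZmodType C) (x : W) : R := complex.Re `|x|.

Lemma rnormE (W : normedZmodType C) (x : W) : (rnorm x)%:C = `|x|.
Proof. exact: ge0_RRe. Qed.

Lemma rnorm_ge0 (W : normedZmodType C) (x : W) : 0 <= rnorm x.
Proof. exact: Re_ge0. Qed.

Lemma rnorm0 (W : normedZmodType C) : rnorm (0 : W) = 0.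
Proof. by rewrite /rnorm normr0. Qed.

Lemma rnormN (W : normedZmodType C) (x : W) : rnorm (- x) = rnorm x.
Proof. by rewrite /rnorm normrN. Qed.

Lemma rnormM (x y : C) : rnorm (x * y) = rnorm x * rnorm y.
Proof. by rewrite {1}/rnorm normrM -!rnormE Re_real_mul. Qed.

Lemma rnorm_conj (x : C) : rnorm (conjC x) = rnorm x.
Proof. by rewrite /rnorm norm_conjC. Qed.

Lemma rnorm_real (a : R) : rnorm a%:C = `|a|.
Proof. by rewrite /rnorm normc_def /= expr0n addr0 sqrtr_sqr. Qed.

Lemma rnorm_eq0 (W : normedZmodType C) (x : W) : rnorm x = 0 -> x = 0.
Proof. by move=> h; apply/eqP; rewrite -normr_eq0 -rnormE h. Qed.

Lemma ler_rnormD (W : normedZmodType C) (x y : W) :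
  rnorm (x + y) <= rnorm x + rnorm y.
Proof. by rewrite -ReD le_Re // ler_normD. Qed.

Lemma rnorm_sqr (z : C) : (rnorm z ^+ 2)%:C = z * conjC z.
Proof. by rewrite -normCK -rnormE rmorphXn. Qed.

Lemma sqr_rnormE (z : C) :
  rnorm z ^+ 2 = complex.Re z ^+ 2 + complex.Im z ^+ 2.
Proof.
rewrite /rnorm normc_def /= sqr_sqrtr //.
by apply: addr_ge0; apply: sqr_ge0.
Qed.

Lemma le_Re_rnorm (z : C) : `|complex.Re z| <= rnorm z.
Proof.
rewrite -(@ler_pXn2r _ 2) ?nnegrE ?rnorm_ge0 // sqr_rnormE -normrX.
by rewrite ger0_norm ?sqr_ge0 // lerDl sqr_ge0.
Qed.

Lemma le_Im_rnorm (z : C) : `|complex.Im z| <= rnorm z.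
Proof.
rewrite -(@ler_pXn2r _ 2) ?nnegrE ?rnorm_ge0 // sqr_rnormE -normrX.
by rewrite ger0_norm ?sqr_ge0 // lerDr sqr_ge0.
Qed.

End ComplexNumbers.

(** * Hilbert norms, inner products and blocks of columns *)

Section ColumnNorms.
Context {R : realType}.
Local Notation C := R[i].

Definition l2sq (W : normedZmodType C) n (x : 'cV[W]_n) : R :=
  \sum_(i < n) rnorm (x i 0) ^+ 2.

Lemma l2normE (W : normedZmodType C) n (x : 'cV[W]_n) :
  l2norm x = Num.sqrt (l2sq x).
Proof. by []. Qed.

Lemma l2sq_ge0 (W : normedZmodType C) n (x : 'cV[W]_n) : 0 <= l2sq x.
Proof. by apply: sumr_ge0 => i _; apply: sqr_ge0. Qed.

Lemma l2norm_ge0 (W : normedZmodType C) n (x : 'cV[W]_n) : 0 <= l2norm x.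
Proof. exact: sqrtr_ge0. Qed.

Lemma sqr_l2norm (W : normedZmodType C) n (x : 'cV[W]_n) :
  l2norm x ^+ 2 = l2sq x.
Proof. by rewrite l2normE sqr_sqrtr ?l2sq_ge0. Qed.

Lemma le_l2norm (W W' : normedZmodType C) n m (x : 'cV[W]_n) (y : 'cV[W']_m) :
  (l2norm x <= l2norm y) = (l2sq x <= l2sq y).
Proof. by rewrite ler_sqrt ?l2sq_ge0. Qed.

Lemma l2norm0 (W : normedZmodType C) n : l2norm (0 : 'cV[W]_n) = 0.
Proof.
rewrite l2normE [l2sq _]big1 ?sqrtr0 // => i _.
by rewrite mxE rnorm0 expr0n.
Qed.

Lemma l2norm_eq0 (W : normedZmodType C) n (x : 'cV[W]_n) : l2norm x = 0 -> x = 0.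
Proof.
move=> x0; have /eqP : l2sq x = 0 by rewrite -sqr_l2norm x0 expr0n.
rewrite psumr_eq0 => [/allP h|i _]; last exact: sqr_ge0.
apply/matrixP => i j; rewrite ord1 mxE; apply: rnorm_eq0; apply/eqP.
by have := h i (mem_index_enum i); rewrite /= sqrf_eq0.
Qed.

Lemma l2norm_scale n (a : C) (x : 'cV[C]_n) :
  l2norm (a *: x) = rnorm a * l2norm x.
Proof.
rewrite !l2normE -[rnorm a]ger0_norm ?rnorm_ge0 // -sqrtr_sqr.
rewrite -sqrtrM ?sqr_ge0 // /l2sq mulr_sumr.
by congr Num.sqrt; apply: eq_bigr => i _; rewrite mxE rnormM exprMn.
Qed.

Lemma rnorm_le_l2norm (W : normedZmodType C) n (x : 'cV[W]_n) i :
  rnorm (x i 0) <= l2norm x.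
Proof.
rewrite -(@ler_pXn2r _ 2) ?nnegrE ?rnorm_ge0 ?l2norm_ge0 // sqr_l2norm.
by rewrite /l2sq (bigD1 i) //= lerDl sumr_ge0 // => j _; apply: sqr_ge0.
Qed.

Definition cdot n (u v : 'cV[C]_n) : C := \sum_(i < n) u i 0 * conjC (v i 0).

Lemma cdotE n (u v : 'cV[C]_n) : cdot u v = (map_mx conjC v^T *m u) 0 0.
Proof. by rewrite mxE; apply: eq_bigr => i _; rewrite !mxE mulrC. Qed.

Lemma psdmxP n (A : 'M[C]_n) : psdmx A <-> forall x, 0 <= cdot (A *m x) x.
Proof. by split => h x; have := h x; rewrite cdotE. Qed.

Lemma cdotuu n (u : 'cV[C]_n) : cdot u u = (l2sq u)%:C.
Proof.
by rewrite /l2sq rmorph_sum; apply: eq_bigr => i _; rewrite -rnorm_sqr.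
Qed.

Lemma cdotC n (u v : 'cV[C]_n) : cdot u v = conjC (cdot v u).
Proof.
by rewrite rmorph_sum; apply: eq_bigr => i _; rewrite rmorphM /= conjCK mulrC.
Qed.

Lemma cdotPl n a (u v w : 'cV[C]_n) :
  cdot (a *: u + v) w = a * cdot u w + cdot v w.
Proof.
rewrite /cdot mulr_sumr -big_split; apply: eq_bigr => i _ /=.
by rewrite !mxE mulrDl mulrA.
Qed.

(** A crude substitute for Cauchy-Schwarz, from |ab| <= a^2 + b^2. It is enough to make the inner
    products of two square summable families summable. *)
Lemma rnorm_cdot_le n (u v : 'cV[C]_n) : rnorm (cdot u v) <= l2sq u + l2sq v.
Proof.
have h i : rnorm (u i 0 * conjC (v i 0)) <=
           rnorm (u i 0) ^+ 2 + rnorm (v i 0) ^+ 2.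
  rewrite rnormM rnorm_conj.
  have := sqr_ge0 (rnorm (u i 0) - rnorm (v i 0)).
  have := sqr_ge0 (rnorm (u i 0)); have := sqr_ge0 (rnorm (v i 0)).
  by move: (rnorm _) (rnorm _) => a b; rewrite !expr2 => *; nra.
rewrite /l2sq -big_split; apply: le_trans (ler_sum _ (fun i _ => h i)).
rewrite /cdot; elim/big_ind2: _ => [|x1 x2 y1 y2 h1 h2|//]; first by rewrite rnorm0.
by apply: le_trans (ler_rnormD _ _) _; apply: lerD.
Qed.

Lemma rnorm_sqrD_le (x y : C) :
  rnorm (x + y) ^+ 2 <= 2 * rnorm x ^+ 2 + 2 * rnorm y ^+ 2.
Proof.
have h := ler_rnormD x y; have h0 := rnorm_ge0 (x + y).
have h1 : rnorm (x + y) ^+ 2 <= (rnorm x + rnorm y) ^+ 2.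
  by rewrite ler_pXn2r ?nnegrE // (le_trans h0).
apply: le_trans h1 _; have := sqr_ge0 (rnorm x - rnorm y).
by move: (rnorm _) (rnorm _) => a b; rewrite !expr2 => *; nra.
Qed.

Lemma l2sqD_le n (u v : 'cV[C]_n) : l2sq (u + v) <= 2 * l2sq u + 2 * l2sq v.
Proof.
rewrite /l2sq !mulr_sumr -big_split; apply: ler_sum => i _ /=.
by rewrite mxE rnorm_sqrD_le.
Qed.

Lemma l2sqZ n (a : C) (x : 'cV[C]_n) : l2sq (a *: x) = rnorm a ^+ 2 * l2sq x.
Proof. by rewrite -!sqr_l2norm l2norm_scale exprMn. Qed.

Lemma l2sq0 n : l2sq (0 : 'cV[C]_n) = 0.
Proof. by rewrite -sqr_l2norm l2norm0 expr0n. Qed.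

Lemma cdot_mxcol k n (u v : 'I_k -> 'cV[C]_n) :
  cdot (\mxcol_(i < k) u i) (\mxcol_(i < k) v i) = \sum_(i < k) cdot (u i) (v i).
Proof.
rewrite cdotE tr_mxcol.
have -> : map_mx conjC (\mxrow_i (v i)^T) = \mxrow_i (map_mx conjC (v i)^T).
  by apply/matrixP => i j; rewrite !mxE.
by rewrite mul_mxrow_mxcol summxE; apply: eq_bigr => i _; rewrite cdotE.
Qed.

Lemma l2sq_mxcol k n (u : 'I_k -> 'cV[C]_n) :
  l2sq (\mxcol_(i < k) u i) = \sum_(i < k) l2sq (u i).
Proof.
apply: (@complexI R); rewrite -cdotuu cdot_mxcol rmorph_sum.
by apply: eq_bigr => i _; rewrite cdotuu.
Qed.

(** Access to [ampl] by blocks: later arguments that apply an amplification to a vector go through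
    this form and avoid indices below [\sum_(i < k) n]. *)
Lemma ampl_mul n (V : lmodType C) (phi : V -> 'M[C]_n) k (x : 'M[V]_k)
    (u : 'I_k -> 'cV[C]_n) :
  ampl phi x *m (\mxcol_(i < k) u i) =
  \mxcol_(i < k) \sum_(j < k) phi (x i j) *m u j.
Proof. exact: mul_mxblock_mxrow. Qed.

End ColumnNorms.

(** * Operator norms of matrices *)

Section OperatorNorms.
Context {R : realType}.
Local Notation C := R[i].

Lemma opnorm_leP (U W : Type) (nU : U -> R) (nW : W -> R) (f : U -> W) (r : R) :
  (opnorm nU nW f <= r%:E)%E <-> forall u, nU u <= 1 -> nW (f u) <= r.
Proof.
split=> [h u u1|h].
  by rewrite -lee_fin; apply: le_trans h; apply: ereal_sup_ubound; exists u.
by apply: ge_ereal_sup => _ [u u1 <-]; rewrite lee_fin h.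
Qed.

Lemma opnorm_ge (U W : Type) (nU : U -> R) (nW : W -> R) (f : U -> W) u :
  nU u <= 1 -> ((nW (f u))%:E <= opnorm nU nW f)%E.
Proof. by move=> u1; apply: ereal_sup_ubound; exists u. Qed.

Lemma mxnorm_EFin m n (A : 'M[C]_(m, n)) :
  (mxnorm A)%:E = opnorm (@l2norm R C n) (@l2norm R C m) (mulmx A).
Proof.
rewrite /mxnorm fineK // fin_real //; apply/andP; split.
  apply: (@lt_le_trans _ _ 0%E); first exact: ltNyr.
  have := opnorm_ge (l2norm (n:=m)) (mulmx A) (u := 0) (nU := @l2norm R C n).
  by rewrite mulmx0 !l2norm0; apply; rewrite ler01.
(* Entries of a vector in the unit ball have modulus at most 1, so the i-th entry of A u is bounded
   by the l1 norm of row i. The resulting bound is crude but finite. *)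
set M := \sum_(i < m) (\sum_(j < n) rnorm (A i j)) ^+ 2.
apply: (@le_lt_trans _ _ (Num.sqrt M)%:E); last exact: ltry.
apply/opnorm_leP => u u1; rewrite l2normE ler_sqrt; last first.
  by apply: sumr_ge0 => i _; apply: sqr_ge0.
apply: ler_sum => i _; rewrite ler_pXn2r ?nnegrE ?rnorm_ge0 //; last first.
  by apply: sumr_ge0 => j _; apply: rnorm_ge0.
rewrite mxE.
apply: (@le_trans _ _ (\sum_(j < n) rnorm (A i j * u j 0))).
  elim/big_ind2: _ => [|x1 x2 y1 y2 h1 h2|//]; first by rewrite rnorm0.
  by apply: le_trans (ler_rnormD _ _) _; apply: lerD.
apply: ler_sum => j _; rewrite rnormM ler_piMr ?rnorm_ge0 //.
by apply: le_trans u1; apply: rnorm_le_l2norm.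
Qed.

Lemma mxnorm_leP m n (A : 'M[C]_(m, n)) (r : R) :
  mxnorm A <= r <-> forall u, l2norm u <= 1 -> l2norm (A *m u) <= r.
Proof. by rewrite -lee_fin mxnorm_EFin; apply: opnorm_leP. Qed.

Lemma l2norm_mul_le m n (A : 'M[C]_(m, n)) u :
  l2norm (A *m u) <= mxnorm A * l2norm u.
Proof.
have [u0|/eqP u0] := eqVneq (l2norm u) 0.
  by rewrite (l2norm_eq0 u0) mulmx0 !l2norm0 mulr0.
have up : 0 < l2norm u by rewrite lt_neqAle l2norm_ge0 andbT eq_sym; apply/eqP.
have := (mxnorm_leP A (mxnorm A)).1 (lexx _) ((l2norm u)^-1%:C *: u).
rewrite -scalemxAr !l2norm_scale rnorm_real ger0_norm ?invr_ge0 ?l2norm_ge0 //.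
rewrite mulVf; last by apply/eqP.
by move=> /(_ (lexx _)); rewrite mulrC ler_pdivrMr.
Qed.

Lemma mxnorm_ge0 m n (A : 'M[C]_(m, n)) : 0 <= mxnorm A.
Proof.
by have /mxnorm_leP/(_ 0) := lexx (mxnorm A); rewrite mulmx0 !l2norm0; apply.
Qed.

Lemma mxnormZ m n (a : C) (A : 'M[C]_(m, n)) :
  mxnorm (a *: A) <= rnorm a * mxnorm A.
Proof.
apply/mxnorm_leP => u u1; rewrite -scalemxAl l2norm_scale.
by apply: ler_wpM2l; [exact: rnorm_ge0|exact: (mxnorm_leP A _).1].
Qed.

End OperatorNorms.

(** * Unconditional sums over an arbitrary index set *)

Section Summation.
Context {R : realType} {S : choiceType}.
Local Notation C := R[i].
Implicit Types (p q u v : S -> R) (F G : S -> C).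

(** Meant for nonnegative families: a supremum of finite partial sums, since the index set need not
    be countable. *)
Definition nnsum p : \bar R := \esum_(s in [set: S]) (p s)%:E.

Definition summ u : bool := (nnsum (fun s => `|u s|%R) < +oo)%E.

Lemma nnsum_ge0 p : (forall s, 0 <= p s) -> (0 <= nnsum p)%E.
Proof. by move=> p0; apply: esum_ge0 => s _; rewrite lee_fin. Qed.

Lemma le_nnsum p q : (forall s, p s <= q s) -> (nnsum p <= nnsum q)%E.
Proof. by move=> h; apply: le_esum => s _; rewrite lee_fin. Qed.

Lemma eq_nnsum p q : p =1 q -> nnsum p = nnsum q.
Proof. by move=> h; apply: eq_esum => s _; rewrite h. Qed.

Lemma nnsumD p q : (forall s, 0 <= p s) -> (forall s, 0 <= q s) ->
  nnsum (fun s => (p s + q s)%R) = (nnsum p + nnsum q)%E.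
Proof.
by move=> p0 q0; rewrite -esumD // => s _; rewrite lee_fin.
Qed.

Lemma nnsum_sum I (r : seq I) (p : I -> S -> R) : (forall i s, 0 <= p i s) ->
  nnsum (fun s => \sum_(i <- r) p i s) = (\sum_(i <- r) nnsum (p i))%E.
Proof.
move=> p0; elim: r => [|i r IH].
  rewrite big_nil /nnsum esum1 // => s _; by rewrite big_nil.
rewrite big_cons -IH -nnsumD //; last by move=> s; apply: sumr_ge0.
by apply: eq_nnsum => s; rewrite big_cons.
Qed.

Lemma nnsum_fineK p : (forall s, 0 <= p s) -> (nnsum p < +oo)%E ->
  (fine (nnsum p))%:E = nnsum p.
Proof. by move=> p0 h; rewrite fineK // ge0_fin_numE // nnsum_ge0. Qed.

Lemma nnsum_leP p (r : R) : (forall s, 0 <= p s) ->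
  (nnsum p <= r%:E)%E <->
  forall A : {fset S}, \sum_(s <- A) p s <= r.
Proof.
move=> p0; split=> [h A|h].
  rewrite -lee_fin -sumEFin; apply: le_trans h; apply: ereal_sup_ubound.
  exists [set` A]; first by split=> //; exact: finite_fset.
  by rewrite fsbig_finite //= set_fsetK.
apply: ge_ereal_sup => _ [A [fA _] <-].
by rewrite fsbig_finite //= sumEFin lee_fin.
Qed.

Lemma nnsum_ge1 p s : (forall s, 0 <= p s) -> ((p s)%:E <= nnsum p)%E.
Proof.
move=> p0; apply: ereal_sup_ubound; exists [set s].
  by split=> //; exact: finite_set1.
by rewrite fsbig_set1.
Qed.

Lemma nnsum_single p s : 0 <= p s -> (forall t, t != s -> p t = 0) ->
  nnsum p = (p s)%:E.
Proof.
move=> p0 h; rewrite -(@esum_set1 R S s (fun t => (p t)%:E)) ?lee_fin //.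
rewrite (esum_mkcond [set s]); apply: eq_esum => t _.
by case: ifPn => //; rewrite notin_setE /= => /eqP /h ->.
Qed.

Lemma nnsumZ p (r : R) : (forall s, 0 <= p s) -> 0 <= r ->
  (nnsum p < +oo)%E -> nnsum (fun s => (r * p s)%R) = (r%:E * nnsum p)%E.
Proof.
have le p' r' : (forall s, 0 <= p' s) -> 0 <= r' -> (nnsum p' < +oo)%E ->
    (nnsum (fun s => (r' * p' s)%R) <= r'%:E * nnsum p')%E.
  move=> p0 r0 fin; rewrite -(nnsum_fineK p0 fin) -EFinM.
  apply/nnsum_leP => [s|A]; first exact: mulr_ge0.
  rewrite -mulr_sumr ler_wpM2l //; apply: (nnsum_leP _ p0).1.
  by rewrite nnsum_fineK.
move=> p0 r0 fin; apply/eqP; rewrite eq_le le //=.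
have [->|/eqP rn0] := eqVneq r 0.
  by rewrite mul0e nnsum_ge0 // => s; rewrite mul0r.
have rp : 0 < r by rewrite lt_neqAle r0 eq_sym andbT; apply/eqP.
have fin' : (nnsum (fun s => (r * p s)%R) < +oo)%E.
  apply: le_lt_trans (le _ _ p0 r0 fin) _.
  by rewrite -(nnsum_fineK p0 fin) -EFinM ltry.
(* The reverse inequality is the same one for the family r p and the factor 1/r. *)
have := le (fun s => r * p s) r^-1 (fun s => mulr_ge0 r0 (p0 s)) _ fin'.
rewrite invr_ge0 => /(_ r0).
have rp0 s : 0 <= r * p s by exact: mulr_ge0.
rewrite (@eq_nnsum _ p); last by move=> s; rewrite mulrA mulVf ?mul1r //; apply/eqP.
rewrite -(nnsum_fineK p0 fin) -(nnsum_fineK rp0 fin') -!EFinM !lee_fin.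
by rewrite mulrC ler_pdivlMr // mulrC.
Qed.

(** [fine] sends an infinite sum to 0, so the value is meaningful only under [summ u]. *)
Definition rsum u : R :=
  fine (nnsum (fun s => Num.max (u s) 0%R)) -
  fine (nnsum (fun s => Num.max (- u s)%R 0%R)).

Lemma max0_ge0 (a : R) : 0 <= Num.max a 0.
Proof. by rewrite le_max lexx orbT. Qed.

Lemma max0_le_norm (a : R) : Num.max a 0 <= `|a|.
Proof. by rewrite ge_max ler_norm normr_ge0. Qed.

Lemma max0N (a : R) : Num.max a 0 - Num.max (- a) 0 = a.
Proof.
have [a0|a0] := leP a 0; have [b0|b0] := leP (- a) 0; lra.
Qed.

Lemma summ_pos u : summ u -> (nnsum (fun s => Num.max (u s) 0%R) < +oo)%E.
Proof. by apply: le_lt_trans; apply: le_nnsum => s; apply: max0_le_norm. Qed.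

Lemma summ_neg u : summ u -> (nnsum (fun s => Num.max (- u s)%R 0%R) < +oo)%E.
Proof.
apply: le_lt_trans; apply: le_nnsum => s.
by rewrite -normrN; apply: max0_le_norm.
Qed.

(** Pointwise, max(u, 0) + q = p + max(-u, 0), and sums of nonnegative families are additive. Being
    free to choose the decomposition reduces additivity and homogeneity of [rsum] to the nonnegative
    case. *)
Lemma rsumE u p q : (forall s, 0 <= p s) -> (forall s, 0 <= q s) ->
  (nnsum p < +oo)%E -> (nnsum q < +oo)%E -> (forall s, u s = p s - q s) ->
  rsum u = fine (nnsum p) - fine (nnsum q).
Proof.
move=> p0 q0 fp fq upq.
have le s : `|u s| <= p s + q s.
  rewrite upq; apply: le_trans (ler_normB _ _) _.
  by rewrite !ger0_norm.
have su : summ u.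
  apply: le_lt_trans (le_nnsum le) _.
  by rewrite nnsumD // -nnsum_fineK // -(nnsum_fineK q0) // -EFinD ltry.
have fpos := summ_pos su; have fneg := summ_neg su.
have pos0 s : 0 <= Num.max (u s) 0 by exact: max0_ge0.
have neg0 s : 0 <= Num.max (- u s) 0 by exact: max0_ge0.
have : (nnsum (fun s => Num.max (u s) 0%R) + nnsum q =
        nnsum p + nnsum (fun s => Num.max (- u s)%R 0%R))%E.
  rewrite -!nnsumD //; apply: eq_nnsum => s.
  by have := max0N (u s); rewrite {3}upq; lra.
rewrite -(nnsum_fineK pos0 fpos) -(nnsum_fineK p0 fp) -(nnsum_fineK q0 fq).
rewrite -(nnsum_fineK neg0 fneg) -!EFinD /rsum => -[]; lra.
Qed.

Lemma summN u : summ u -> summ (fun s => - u s).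
Proof. by apply: le_lt_trans; apply: le_nnsum => s; rewrite normrN. Qed.

Lemma summZ (r : R) u : summ u -> summ (fun s => r * u s).
Proof.
move=> su.
apply: (@le_lt_trans _ _ (nnsum (fun s => `|r| * `|u s|))).
  by apply: le_nnsum => s; rewrite normrM.
by rewrite nnsumZ // -nnsum_fineK // -EFinM ltry.
Qed.

Lemma rsumD u v : summ u -> summ v ->
  rsum (fun s => u s + v s) = rsum u + rsum v.
Proof.
move=> su sv.
have fu := summ_pos su; have fu' := summ_neg su.
have fv := summ_pos sv; have fv' := summ_neg sv.
have H (w : S -> R) s : 0 <= Num.max (w s) 0 := max0_ge0 (w s).
have HN (w : S -> R) s : 0 <= Num.max (- w s) 0 := max0_ge0 (- w s).
rewrite (@rsumE _ (fun s => Num.max (u s) 0 + Num.max (v s) 0)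
   (fun s => Num.max (- u s) 0 + Num.max (- v s) 0)) ?nnsumD //.
- rewrite -(nnsum_fineK (H u) fu) -(nnsum_fineK (H v) fv).
  rewrite -(nnsum_fineK (HN u) fu') -(nnsum_fineK (HN v) fv') -!EFinD /rsum.
  rewrite [LHS]/=; lra.
- by move=> s; apply: addr_ge0; apply: max0_ge0.
- by move=> s; apply: addr_ge0; apply: max0_ge0.
- by rewrite -(nnsum_fineK (H u)) // -(nnsum_fineK (H v)) // -EFinD ltry.
- by rewrite -(nnsum_fineK (HN u)) // -(nnsum_fineK (HN v)) // -EFinD ltry.
- by move=> s; have := max0N (u s); have := max0N (v s); lra.
Qed.

Lemma rsumN u : rsum (fun s => - u s) = - rsum u.
Proof.
rewrite /rsum opprB; congr (_ - fine _); apply: eq_nnsum => s.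
by rewrite opprK.
Qed.

Lemma ge0_rsum u : (forall s, 0 <= u s) -> rsum u = fine (nnsum u).
Proof.
move=> u0; rewrite /rsum (@eq_nnsum _ u) => [|s]; last first.
  by apply/max_idPl.
rewrite [X in _ - fine X](_ : _ = 0%E) ?subr0 // /nnsum esum1 // => s _.
by congr EFin; apply/max_idPr; rewrite oppr_le0.
Qed.

Lemma rsumZ (r : R) u : summ u -> rsum (fun s => r * u s) = r * rsum u.
Proof.
move=> su; wlog r0 : r / 0 <= r => [hw|].
  have [/hw //|r0] := leP 0 r.
  have := hw (- r); rewrite oppr_ge0 => /(_ (ltW r0)) h.
  have -> : (fun s => r * u s) = fun s => - (- r * u s).
    by apply/funext => s; rewrite mulNr opprK.
  by rewrite rsumN h mulNr opprK.
have fu := summ_pos su; have fu' := summ_neg su.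
have H s := max0_ge0 (u s); have HN s := max0_ge0 (- u s).
rewrite (@rsumE _ (fun s => r * Num.max (u s) 0%R)
  (fun s => r * Num.max (- u s)%R 0%R)).
- by rewrite !nnsumZ // /rsum -(nnsum_fineK H fu) -(nnsum_fineK HN fu') /= mulrBr.
- by move=> s; apply: mulr_ge0.
- by move=> s; apply: mulr_ge0.
- by rewrite nnsumZ // -(nnsum_fineK H) // -EFinM ltry.
- by rewrite nnsumZ // -(nnsum_fineK HN) // -EFinM ltry.
- by move=> s; rewrite -mulrBr max0N.
Qed.

Definition csumm F : bool := (nnsum (fun s => rnorm (F s)) < +oo)%E.

Definition csum F : C :=
  rsum (fun s => complex.Re (F s)) +i* rsum (fun s => complex.Im (F s)).

Lemma csumm_Re F : csumm F -> summ (fun s => complex.Re (F s)).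
Proof. by apply: le_lt_trans; apply: le_nnsum => s; apply: le_Re_rnorm. Qed.

Lemma csumm_Im F : csumm F -> summ (fun s => complex.Im (F s)).
Proof. by apply: le_lt_trans; apply: le_nnsum => s; apply: le_Im_rnorm. Qed.

Lemma csummD F G : csumm F -> csumm G -> csumm (fun s => F s + G s).
Proof.
move=> sF sG.
apply: (@le_lt_trans _ _ (nnsum (fun s => rnorm (F s) + rnorm (G s)))).
  by apply: le_nnsum => s; apply: ler_rnormD.
have H (K : S -> C) s : 0 <= rnorm (K s) := rnorm_ge0 (K s).
by rewrite nnsumD // -(nnsum_fineK (H F)) // -(nnsum_fineK (H G)) // -EFinD ltry.
Qed.

Lemma csummZ (a : C) F : csumm F -> csumm (fun s => a * F s).
Proof.
move=> sF.
rewrite /csumm (@eq_nnsum _ (fun s => rnorm a * rnorm (F s))); last first.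
  by move=> s; rewrite rnormM.
have H s := rnorm_ge0 (F s).
by rewrite nnsumZ ?rnorm_ge0 // -(nnsum_fineK H) // -EFinM ltry.
Qed.

Lemma csum0 : csum (fun=> 0) = 0.
Proof.
rewrite /csum /= ge0_rsum // /nnsum esum1 //.
Qed.

Lemma csumD F G : csumm F -> csumm G ->
  csum (fun s => F s + G s) = csum F + csum G.
Proof.
move=> sF sG; apply/eqP; rewrite eq_complex /=.
rewrite -!rsumD ?csumm_Re ?csumm_Im //.
by apply/andP; split; apply/eqP; congr rsum; apply/funext => s;
  rewrite ?ReD ?ImD.
Qed.

Lemma csumZ (a : C) F : csumm F -> csum (fun s => a * F s) = a * csum F.
Proof.
move=> sF; have sr := csumm_Re sF; have si := csumm_Im sF.
have -> : a * csum F =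
  (complex.Re a * rsum (fun s => complex.Re (F s)) -
   complex.Im a * rsum (fun s => complex.Im (F s))) +i*
  (complex.Re a * rsum (fun s => complex.Im (F s)) +
   complex.Im a * rsum (fun s => complex.Re (F s))).
  by case: a.
rewrite -!rsumZ // -rsumN -!rsumD ?summN ?summZ //.
rewrite /csum; congr (_ +i* _); congr rsum; apply/funext => s;
  by case: a (F s) => [? ?] [? ?].
Qed.

Lemma csum_sum I (r : seq I) (F : I -> S -> C) : (forall i, csumm (F i)) ->
  csum (fun s => \sum_(i <- r) F i s) = \sum_(i <- r) csum (F i).
Proof.
move=> sF.
suff [] : csumm (fun s => \sum_(i <- r) F i s) /\
  csum (fun s => \sum_(i <- r) F i s) = \sum_(i <- r) csum (F i) by [].
elim: r => [|i r [IHs IH]].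
  rewrite big_nil; have -> : (fun s => \sum_(i <- [::]) F i s) = fun=> 0.
    by apply/funext => s; rewrite big_nil.
  split; last exact: csum0.
  by rewrite /csumm /nnsum esum1 ?ltry // => s _; rewrite rnorm0.
have -> : (fun s => \sum_(i <- i :: r) F i s) =
          (fun s => F i s + \sum_(i <- r) F i s).
  by apply/funext => s; rewrite big_cons.
by rewrite big_cons csumD // IH; split=> //; exact: csummD.
Qed.

Lemma csum_conj F : csum (fun s => conjC (F s)) = conjC (csum F).
Proof.
rewrite /csum conjCE /= -rsumN; congr (_ +i* _); congr rsum; apply/funext => s;
  by rewrite conjCE; case: (F s).
Qed.

Lemma csum_real u : (forall s, 0 <= u s) ->
  csum (fun s => (u s)%:C) = (fine (nnsum u))%:C.
Proof.
move=> u0; rewrite /csum /= ge0_rsum //; congr (_ +i* _).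
by rewrite ge0_rsum // /nnsum esum1.
Qed.

Lemma csum_ge0 F : (forall s, 0 <= F s) -> 0 <= csum F.
Proof.
move=> F0; have -> : F = fun s => (complex.Re (F s))%:C.
  by apply/funext => s; rewrite ge0_RRe.
have R0 s : 0 <= complex.Re (F s) by exact: Re_ge0.
by rewrite csum_real // ler0c fine_ge0 // nnsum_ge0.
Qed.

Lemma csum_single F s : (forall t, t != s -> F t = 0) -> csum F = F s.
Proof.
have rs u : (forall t, t != s -> u t = 0) -> rsum u = u s.
  move=> h; rewrite /rsum !(@nnsum_single _ s) /= ?max0_ge0 ?max0N //.
    by move=> t /h ->; rewrite oppr0 maxxx.
  by move=> t /h ->; rewrite maxxx.
move=> h; rewrite /csum !rs //; first by case: (F s).
  by move=> t /h ->.
by move=> t /h ->.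
Qed.

End Summation.

(** * Cauchy-Schwarz and the triangle inequality for a dot product *)

Section DotProductNorm.
Context {R : realType} {U : lmodType R[i]} (form : {dot U for conjC}).

(** Stated for a bare dot product, because the norm of the Hilbert sum is defined from it. The proof
    expands the squared length of u - a v, where a v is the orthogonal projection of u onto the line
    of v. *)
Lemma dot_CauchySchwarz (u v : U) :
  `|form u v| ^+ 2 <= form u u * form v v.
Proof.
have [->|v0] := eqVneq v 0.
  by rewrite !linear0r normr0 expr0n mulr0.
have vv : 0 < form v v by rewrite dnorm_gt0.
set d := form u v; pose a := d / form v v.
have dE : form v u = conjC d by rewrite (hermC form v u) expr0 mul1r.
have : 0 <= form (u - a *: v) (u - a *: v) by exact: dnorm_ge0.
rewrite dnormB dnormZ linearZr_LR /= -/d.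
have aE : conjC a = conjC d / form v v.
  by rewrite /a rmorphM fmorphV /= (geC0_conj (ltW vv)).
have -> : conjC a * d = `|d| ^+ 2 / form v v by rewrite aE normCK; ring.
have -> : conjC (`|d| ^+ 2 / form v v) = `|d| ^+ 2 / form v v.
  by rewrite geC0_conj // divr_ge0 ?exprn_ge0 // ltW.
have -> : `|a| ^+ 2 * form v v = `|d| ^+ 2 / form v v.
  rewrite /a normrM normfV exprMn (gtr0_norm vv) exprVn -mulrA; congr (_ * _).
  by rewrite expr2 invfM -mulrA mulVf ?mulr1 // gt_eqF.
by rewrite opprD addrA addrK subr_ge0 ler_pdivrMr.
Qed.

Lemma dot_triangle (u v : U) :
  sqrtC (form (u + v) (u + v)) <= sqrtC (form u u) + sqrtC (form v v).
Proof.
have su := sqrt_dnorm_ge0 form u; have sv := sqrt_dnorm_ge0 form v.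
rewrite -(@ler_pXn2r _ 2) ?nnegrE ?sqrt_dnorm_ge0 ?addr_ge0 //.
rewrite sqrrD !sqrtCK dnormD /= [leRHS]addrAC lerD2l.
set d := form u v.
have dle : `|d| <= sqrtC (form u u) * sqrtC (form v v).
  rewrite -(@ler_pXn2r _ 2) ?nnegrE ?mulr_ge0 // exprMn !sqrtCK.
  exact: dot_CauchySchwarz.
apply: (@le_trans _ _ (`|d| *+ 2)); last by rewrite lerMn2r.
have : `|d + conjC d| <= `|d| + `|d|.
  by rewrite -{2}[ `|d|]norm_conjC ler_normD.
rewrite -mulr2n; apply: le_trans; apply: real_ler_norm.
by rewrite CrealE rmorphD /= conjCK addrC.
Qed.

End DotProductNorm.

(* The Hilbert sum of the spaces C^(n s), s : S: its elements are the square
   summable functions on the disjoint union of the index sets 'I_(n s). *)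
Definition sum_index (S : choiceType) (n : S -> nat) : Type := {s : S & 'I_(n s)}.

Definition block (R : realType) (S : choiceType) (n : S -> nat)
    (f : sum_index n -> R[i]) (s : S) : 'cV[R[i]]_(n s) :=
  \col_i f (Tagged (fun s => 'I_(n s)) i).

(** * The Hilbert sum as an inner product space *)

Section HilbertSum.
Context {R : realType}.
Local Notation C := R[i].

Definition square_summable (S : choiceType) (n : S -> nat) :
    {pred (sum_index n -> C)} :=
  [pred f : sum_index n -> C | (nnsum (fun s => l2sq (block f s)) < +oo)%E].

Section SquareSummable.
Context {S : choiceType} {n : S -> nat}.
Implicit Types f g : sum_index n -> C.

Lemma blockP f g : (forall s, block f s = block g s) -> f = g.
Proof.
move=> h; apply/funext => -[s i].
by have /matrixP/(_ i 0) := h s; rewrite !mxE.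
Qed.

Lemma block_linear s : linear (fun f => block f s).
Proof. by move=> a f g; apply/matrixP => i j; rewrite !mxE. Qed.

Lemma block0 s : block (0 : sum_index n -> C) s = 0.
Proof. by apply/matrixP => i j; rewrite !mxE. Qed.

Lemma square_summable_submod : submod_closed (@square_summable S n).
Proof.
split=> [|a f g].
  rewrite inE /nnsum esum1 ?ltry // => s _.
  by rewrite block0 l2sq0.
rewrite !inE => sf sg.
pose p s := 2 * rnorm a ^+ 2 * l2sq (block f s).
pose q s := 2 * l2sq (block g s).
have p0 s : 0 <= p s by rewrite !mulr_ge0 ?exprn_ge0 ?rnorm_ge0 ?l2sq_ge0.
have q0 s : 0 <= q s by rewrite !mulr_ge0 ?l2sq_ge0.
apply: (@le_lt_trans _ _ (nnsum (fun s => p s + q s))).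
  apply: le_nnsum => s; rewrite block_linear; apply: le_trans (l2sqD_le _ _) _.
  by rewrite l2sqZ /p /q mulrA.
have fs s : 0 <= l2sq (block f s) by exact: l2sq_ge0.
have gs s : 0 <= l2sq (block g s) by exact: l2sq_ge0.
rewrite nnsumD // !nnsumZ ?mulr_ge0 ?exprn_ge0 ?rnorm_ge0 //.
by rewrite -(nnsum_fineK fs sf) -(nnsum_fineK gs sg) -!EFinM -EFinD ltry.
Qed.

HB.instance Definition _ := GRing.isSubmodClosed.Build C (sum_index n -> C)
  (@square_summable S n) square_summable_submod.

End SquareSummable.

Record hilbertSum (S : choiceType) (n : S -> nat) := HilbertSum {
  coords :> sum_index n -> C;
  coords_summable : coords \in @square_summable S n }.

Section HilbertSumStructure.
Context {S : choiceType} {n : S -> nat}.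
Local Notation H := (hilbertSum n).

HB.instance Definition _ := [isSub for @coords S n].
HB.instance Definition _ := [Choice of H by <:].
HB.instance Definition _ := [SubChoice_isSubLmodule of H by <:].

Definition component s (f : H) : 'cV[C]_(n s) := block f s.

Lemma component_is_linear s : linear (component s).
Proof. by move=> a f g; rewrite /component -block_linear. Qed.

HB.instance Definition _ s := GRing.isLinear.Build C H 'cV[C]_(n s) *:%R
  (component s) (component_is_linear s).

Lemma componentD f g s : component s (f + g) = component s f + component s g.
Proof. exact: (linearD (component s)). Qed.

Lemma componentZ a f s : component s (a *: f) = a *: component s f.
Proof. exact: (linearZ_LR (component s)). Qed.

Lemma componentP (f g : H) : (forall s, component s f = component s g) -> f = g.
Proof. by move=> h; apply: val_inj; apply: blockP. Qed.

Lemma component_summable (f : H) : (nnsum (fun s => l2sq (component s f)) < +oo)%E.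
Proof. exact: coords_summable. Qed.

Definition hsq (f : H) : R := fine (nnsum (fun s => l2sq (component s f))).

Lemma hsq_fineK (f : H) : (hsq f)%:E = nnsum (fun s => l2sq (component s f)).
Proof.
by apply: nnsum_fineK; [move=> s; exact: l2sq_ge0|exact: component_summable].
Qed.

Lemma hsq_ge0 (f : H) : 0 <= hsq f.
Proof. by rewrite fine_ge0 // nnsum_ge0 // => s; exact: l2sq_ge0. Qed.

Lemma l2sq_component_le (f : H) s : l2sq (component s f) <= hsq f.
Proof.
rewrite -lee_fin hsq_fineK.
by apply: (@nnsum_ge1 _ _ (fun s => l2sq (component s f))) => t; exact: l2sq_ge0.
Qed.

Definition hdot (f g : H) : C :=
  csum (fun s => cdot (component s f) (component s g)).

Lemma cdot_csumm (f g : H) : csumm (fun s => cdot (component s f) (component s g)).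
Proof.
apply: (@le_lt_trans _ _
  (nnsum (fun s => l2sq (component s f) + l2sq (component s g)))).
  by apply: le_nnsum => s; exact: rnorm_cdot_le.
rewrite nnsumD; try by move=> s; exact: l2sq_ge0.
by rewrite -!hsq_fineK -EFinD ltry.
Qed.

Lemma hdotE (f : H) : hdot f f = (hsq f)%:C.
Proof.
rewrite /hdot -csum_real => [|s]; last exact: l2sq_ge0.
by congr csum; apply/funext => s; rewrite cdotuu.
Qed.

Lemma hdotC (f g : H) : hdot f g = (-1) ^+ false * conjC (hdot g f).
Proof.
rewrite expr0 mul1r /hdot -csum_conj; congr csum; apply/funext => s.
exact: cdotC.
Qed.

Lemma hdotPl a (f g h : H) : hdot (a *: f + g) h = a * hdot f h + hdot g h.
Proof.
rewrite /hdot -csumZ ?cdot_csumm // -csumD ?cdot_csumm //.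
  by congr csum; apply/funext => s; rewrite componentD componentZ cdotPl.
by apply: csummZ; exact: cdot_csumm.
Qed.

Lemma hdot_bilinear :
  bilinear_for ( *%R : GRing.Scale.law C C)
    (conjC \; *%R : GRing.Scale.law C C) hdot.
Proof.
split=> [h a f g|h a f g] /=; first exact: hdotPl.
rewrite hdotC hdotPl expr0 mul1r rmorphD rmorphM /=.
by rewrite (hdotC h f) (hdotC h g) expr0 !mul1r.
Qed.

Lemma hdot_gt0 (f : H) : f != 0 -> 0 < hdot f f.
Proof.
move=> f0; rewrite hdotE ltcR lt_neqAle hsq_ge0 andbT eq_sym.
apply: contra f0 => /eqP h; apply/eqP; apply: componentP => s.
rewrite (linear0 (component s)).
apply: l2norm_eq0; apply/eqP; rewrite -sqrf_eq0 sqr_l2norm.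
by rewrite eq_le l2sq_ge0 andbT -h l2sq_component_le.
Qed.

HB.instance Definition _ := bilinear_isBilinear.Build C H H C
  ( *%R : GRing.Scale.law C C) (conjC \; *%R : GRing.Scale.law C C) hdot
  hdot_bilinear.
HB.instance Definition _ := isHermitianSesquilinear.Build C H false conjC hdot hdotC.
HB.instance Definition _ := isDotProduct.Build C H hdot hdot_gt0.

Definition hnorm (f : H) : C := sqrtC (hdot f f).

Lemma hnormD (f g : H) : hnorm (f + g) <= hnorm f + hnorm g.
Proof. exact: (dot_triangle hdot). Qed.

Lemma hnormZ (a : C) (f : H) : hnorm (a *: f) = `|a| * hnorm f.
Proof.
rewrite /hnorm (dnormZ hdot) sqrtCM ?nnegrE ?exprn_ge0 ?(dnorm_ge0 hdot) //.
by rewrite sqrCK.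
Qed.

Lemma hnorm_eq0 (f : H) : hnorm f = 0 -> f = 0.
Proof. by move=> /eqP; rewrite (sqrt_dnorm_eq0 hdot) => /eqP. Qed.

HB.instance Definition _ := Lmodule_isNormed.Build C H hnormD hnormZ hnorm_eq0.

Lemma hilbertSum_normE (f : H) : hdot f f = `|f| ^+ 2.
Proof. by rewrite -[RHS]/(hnorm f ^+ 2) /hnorm sqrtCK. Qed.

Lemma rnorm_hsq (f : H) : rnorm f ^+ 2 = hsq f.
Proof.
by apply: (@complexI R); rewrite rmorphXn /= rnormE -hilbertSum_normE hdotE.
Qed.

End HilbertSumStructure.
End HilbertSum.

(** * Completeness of the Hilbert sum *)

Section HilbertSumComplete.
Context {R : realType} {S : choiceType} {n : S -> nat}.
Local Notation C := R[i].
Local Notation H := (@hilbertSum R S n).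

(** Coordinates are 1-Lipschitz, so Cauchy filters are Cauchy in each coordinate. *)
Lemma rnorm_coord_le (f : H) j : rnorm (f j) <= rnorm f.
Proof.
case: j => s i.
rewrite -(@ler_pXn2r _ 2) ?nnegrE ?rnorm_ge0 // rnorm_hsq.
apply: le_trans (l2sq_component_le f s).
have -> : f (existT _ s i) = component s f i 0 by rewrite mxE.
by rewrite -sqr_l2norm ler_pXn2r ?nnegrE ?rnorm_ge0 ?l2norm_ge0 // rnorm_le_l2norm.
Qed.

Lemma ltr0c (e : R) : ((0 : C) < e%:C) = (0 < e).
Proof. exact: ltcR. Qed.

Lemma ball_rnorm (f g : H) (e : R) : ball f e%:C g <-> rnorm (f - g) < e.
Proof. by rewrite -ball_normE /ball_ /= -rnormE ltcR. Qed.

(* [proj] is Re or Im. *)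
Lemma cauchy_coord_cvg (F : set_system H) (proj : C -> R) j :
  {morph proj : x y / x - y} -> (forall z, `|proj z| <= rnorm z) ->
  ProperFilter F -> cauchy F -> cvg ((fun f : H => proj (f j)) @ F).
Proof.
move=> projB projle FF Fc; apply: cauchy_cvg; apply: cauchy_exP => e e0.
have /cauchyP/(_ e%:C) := Fc; rewrite ltr0c => /(_ e0)[f0 Ff0].
exists (proj (f0 j)).
rewrite -[_ (ball _ e)]/(F [set g : H | ball (proj (f0 j)) e (proj (g j))]).
apply: filterS Ff0 => g /ball_rnorm hg /=.
suff : `|proj (f0 j) - proj (g j)| < e by rewrite -ball_normE.
rewrite -projB; apply: le_lt_trans (projle _) _.
exact: le_lt_trans (rnorm_coord_le (f0 - g) j) hg.
Qed.

(** A squared block norm is a polynomial in finitely many real coordinates, so coordinatewise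
    convergence suffices. The limit [g] is a bare function here, as its square summability is shown
    afterwards. *)
Lemma cvg_l2sq_block (F : set_system H) (FF : ProperFilter F)
    (g h : sum_index n -> C) s :
  (forall j, (fun f : H => complex.Re (f j)) @ F --> complex.Re (g j)) ->
  (forall j, (fun f : H => complex.Im (f j)) @ F --> complex.Im (g j)) ->
  (fun f : H => l2sq (block (coords f - h) s)) @ F --> l2sq (block (g - h) s).
Proof.
move=> cR cI.
pose T i : sum_index n := Tagged (fun s => 'I_(n s)) (i : 'I_(n s)).
have lE (f : sum_index n -> C) : l2sq (block f s) =
    \sum_i (complex.Re (f (T i)) * complex.Re (f (T i)) +
            complex.Im (f (T i)) * complex.Im (f (T i))).
  by apply: eq_bigr => i _; rewrite mxE sqr_rnormE.
rewrite lE; under eq_fun do rewrite lE.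
apply: cvg_big => [|i _]; first exact: add_continuous.
move: (T i) => j.
have aE (f : sum_index n -> C) : complex.Re ((f - h) j) =
    complex.Re (f j) - complex.Re (h j).
  by rewrite -[(f - h) j]/(f j - h j); case: (f j) (h j) => [? ?] [? ?].
have bE (f : sum_index n -> C) : complex.Im ((f - h) j) =
    complex.Im (f j) - complex.Im (h j).
  by rewrite -[(f - h) j]/(f j - h j); case: (f j) (h j) => [? ?] [? ?].
rewrite aE bE; under eq_fun do rewrite aE bE.
by apply: cvgD; apply: cvgM; apply: cvgB => //; apply: cvg_cst.
Qed.

(** The candidate limit is taken coordinate by coordinate, which alone does not give convergence in
    norm. The missing estimate [close] is a Fatou argument: on finitely many blocks the squared
    distance to f0 passes to the limit, and the supremum over finite sets of blocks keeps the
    bound. *)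
Lemma hilbertSum_complete (F : set_system H) :
  ProperFilter F -> cauchy F -> cvg F.
Proof.
move=> FF Fc.
pose a j := lim ((fun f : H => complex.Re (f j)) @ F).
pose b j := lim ((fun f : H => complex.Im (f j)) @ F).
have ca j : (fun f : H => complex.Re (f j)) @ F --> a j.
  apply: cauchy_coord_cvg => //; last exact: le_Re_rnorm.
  by move=> [? ?] [? ?].
have cb j : (fun f : H => complex.Im (f j)) @ F --> b j.
  apply: cauchy_coord_cvg => //; last exact: le_Im_rnorm.
  by move=> [? ?] [? ?].
pose g : sum_index n -> C := fun j => a j +i* b j.
have close (e : R) (f0 : H) : 0 < e -> F (ball f0 e%:C) ->
    (nnsum (fun s => l2sq (block (g - coords f0)%R s)) <= (e ^+ 2)%:E)%E.
  move=> e0 Ff0; apply/nnsum_leP => [s|A]; first exact: l2sq_ge0.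
  have cA :
      (fun f : H => \sum_(s <- A) l2sq (block (coords f - coords f0) s)) @ F -->
            \sum_(s <- A) l2sq (block (g - coords f0) s).
    apply: cvg_big => [|s _]; first exact: add_continuous.
    exact: cvg_l2sq_block.
  rewrite -(cvg_lim _ cA) //; apply: limr_le; first by apply: cvgP cA.
  apply: filterS Ff0 => f /ball_rnorm hf.
  apply: (@le_trans _ _ (hsq (f - f0))).
    apply: (nnsum_leP _ _).1; first by move=> s; exact: l2sq_ge0.
    by rewrite hsq_fineK.
  rewrite -rnorm_hsq ler_pXn2r ?nnegrE ?rnorm_ge0 ?(ltW e0) //.
  by rewrite -rnormN opprB ltW.
have gS : g \in @square_summable R S n.
  (* By [close], g differs from some element f0 of H by a square summable function; the radius 1 is
     arbitrary. *)
  have /cauchyP/(_ 1) := Fc; rewrite ltr01 => /(_ isT)[f0 Ff0].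
  rewrite -(subrK (coords f0) g); apply: rpredD; last exact: coords_summable.
  by apply: le_lt_trans (close 1 f0 ltr01 Ff0) _; exact: ltry.
pose G : H := HilbertSum gS.
apply/cvg_ex; exists G; apply/cvgrPdist_le => eps eps0.
have [e epsE] : exists e : R, eps = e%:C.
  by exists (complex.Re eps); rewrite ge0_RRe // ltW.
move: eps0; rewrite {eps}epsE ltr0c => e0.
have e20 : 0 < e / 2 by rewrite divr_gt0.
have /cauchyP/(_ (e / 2)%:C) := Fc; rewrite ltr0c => /(_ e20)[f0 Ff0].
have hG : rnorm (G - f0) <= e / 2.
  rewrite -(@ler_pXn2r _ 2) ?nnegrE ?rnorm_ge0 ?(ltW e20) // rnorm_hsq.
  by rewrite -lee_fin hsq_fineK; exact: close.
apply: filterS Ff0 => f /ball_rnorm hf; rewrite -rnormE lecR.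
have -> : G - f = (G - f0) + (f0 - f) by rewrite addrA subrK.
by apply: le_trans (ler_rnormD _ _) _; rewrite [e]splitr lerD // ltW.
Qed.

HB.instance Definition _ := Uniform_isComplete.Build H hilbertSum_complete.

Definition hilbertSumSpace : hilbertSpace R :=
  HilbertSpace (@hilbertSum_normE R S n).

End HilbertSumComplete.

(** * Block diagonal operators on the Hilbert sum *)

Section BlockDiagonal.
Context {R : realType} {S : choiceType} {n : S -> nat}.
Local Notation C := R[i].
Local Notation H := (@hilbertSum R S n).

(** A sum of indicators of tagged indices, so that no cast of [c] along an equality of block indices
    is needed. *)
Definition embed_fun s0 (c : 'cV[C]_(n s0)) (j : {s : S & 'I_(n s)}) : C :=
  \sum_(i < n s0) c i 0 * (j == Tagged (fun s => 'I_(n s)) i)%:R.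

Lemma block_embed s0 (c : 'cV[C]_(n s0)) : block (embed_fun c) s0 = c.
Proof.
apply/matrixP => i k; rewrite ord1 mxE /embed_fun (bigD1 i) //= eqxx mulr1.
by rewrite big1 ?addr0 // => j /negbTE ji; rewrite eq_Tagged eq_sym ji mulr0.
Qed.

Lemma block_embed_neq s0 (c : 'cV[C]_(n s0)) s : s != s0 ->
  block (embed_fun c) s = 0.
Proof.
move=> ss0; apply/matrixP => i k; rewrite ord1 !mxE /embed_fun big1 // => j _.
by rewrite [_ == _](introF eqP) ?mulr0 // => -[es _]; rewrite es eqxx in ss0.
Qed.

Lemma embed_summable s0 (c : 'cV[C]_(n s0)) :
  embed_fun c \in @square_summable R S n.
Proof.
rewrite inE (@nnsum_single _ _ _ s0) ?ltry ?l2sq_ge0 // => t ts.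
by rewrite block_embed_neq // l2sq0.
Qed.

Definition embed s0 (c : 'cV[C]_(n s0)) : H := HilbertSum (embed_summable c).

Lemma component_embed s0 (c : 'cV[C]_(n s0)) : component s0 (embed c) = c.
Proof. exact: block_embed. Qed.

Lemma component_embed_neq s0 (c : 'cV[C]_(n s0)) s : s != s0 ->
  component s (embed c) = 0.
Proof. exact: block_embed_neq. Qed.

Definition blockdiag_fun (A : forall s, 'M[C]_(n s)) (f : sum_index n -> C) :
  sum_index n -> C :=
  fun j => (A (tag j) *m block f (tag j)) (tagged j) 0.

Lemma block_blockdiag A f s : block (blockdiag_fun A f) s = A s *m block f s.
Proof. by apply/matrixP => i k; rewrite ord1 mxE. Qed.

(* Junk value 0 when the blockwise product is not square summable. *)
Definition blockdiag (A : forall s, 'M[C]_(n s)) (f : H) : H :=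
  insubd (0 : H) (blockdiag_fun A f).

(** The uniform bound M makes the blockwise product square summable, so the default value of
    [blockdiag] does not occur. *)
Lemma component_blockdiag A (M : R) (f : H) s :
  (forall s, mxnorm (A s) <= M) ->
  component s (blockdiag A f) = A s *m component s f.
Proof.
move=> AM; rewrite /component -block_blockdiag /blockdiag insubdK //.
rewrite -[_ \in _]/(_ < +oo)%E.
have M0 : 0 <= M := le_trans (mxnorm_ge0 _) (AM s).
apply: (@le_lt_trans _ _ (nnsum (fun s => M ^+ 2 * l2sq (component s f)))).
  apply: le_nnsum => t; rewrite block_blockdiag -!sqr_l2norm -exprMn.
  rewrite ler_pXn2r ?nnegrE ?mulr_ge0 ?l2norm_ge0 //.
  by apply: le_trans (l2norm_mul_le _ _) _; rewrite ler_wpM2r ?l2norm_ge0.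
rewrite nnsumZ ?exprn_ge0 ?component_summable //; last first.
  by move=> t; exact: l2sq_ge0.
by rewrite -hsq_fineK -EFinM ltry.
Qed.

Lemma blockdiag_linear A (M : R) : (forall s, mxnorm (A s) <= M) ->
  linear (blockdiag A).
Proof.
move=> AM a f g; apply: componentP => s.
rewrite (component_blockdiag (a *: f + g) s AM).
rewrite (componentD (a *: f) g) (componentZ a f).
rewrite (componentD (a *: blockdiag A f)) (componentZ a (blockdiag A f)).
rewrite [X in _ = _ *: X + _](component_blockdiag f s AM).
by rewrite [X in _ = _ + X](component_blockdiag g s AM) mulmxDr scalemxAr.
Qed.

(** The regrouping of H^k as the Hilbert sum over s of the spaces (C^(n s))^k. On the summand s, a
    matrix of block diagonal operators acts as one amplified matrix. *)
Definition stack k s (u : 'cV[H]_k) : 'cV[C]_(\sum_(l < k) n s) :=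
  \mxcol_l component s (u l 0).

Lemma l2sq_stack k (u : 'cV[H]_k) :
  (l2sq u)%:E = nnsum (fun s => l2sq (stack s u)).
Proof.
under eq_nnsum do rewrite l2sq_mxcol.
rewrite nnsum_sum; last by move=> i s; exact: l2sq_ge0.
by rewrite -sumEFin; apply: eq_bigr => l _; rewrite rnorm_hsq hsq_fineK.
Qed.

Lemma sum_hdot_stack k (u v : 'cV[H]_k) :
  \sum_l hdot (u l 0) (v l 0) = csum (fun s => cdot (stack s u) (stack s v)).
Proof.
rewrite -csum_sum => [|l]; last exact: cdot_csumm.
by congr csum; apply/funext => s; rewrite cdot_mxcol.
Qed.

Lemma l2norm_stack_ge k (u : 'cV[H]_k) s : l2norm (stack s u) <= l2norm u.
Proof.
rewrite le_l2norm -lee_fin l2sq_stack.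
apply: (@nnsum_ge1 _ _ (fun s => l2sq (stack s u))) => t; exact: l2sq_ge0.
Qed.

Lemma l2norm_stack_le k k' (u : 'cV[H]_k) (v : 'cV[H]_k') (M : R) : 0 <= M ->
  (forall s, l2norm (stack s v) <= M * l2norm (stack s u)) ->
  l2norm v <= M * l2norm u.
Proof.
move=> M0 h.
rewrite -(@ler_pXn2r _ 2) ?nnegrE ?mulr_ge0 ?l2norm_ge0 // exprMn !sqr_l2norm.
have u0 s : 0 <= l2sq (stack s u) by exact: l2sq_ge0.
rewrite -lee_fin EFinM !l2sq_stack -nnsumZ ?exprn_ge0 //; last first.
  by rewrite -l2sq_stack ltry.
apply: le_nnsum => s; rewrite -!sqr_l2norm -exprMn.
by rewrite ler_pXn2r ?nnegrE ?mulr_ge0 ?l2norm_ge0.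
Qed.

Lemma rnorm_blockdiag_le A (M : R) (f : H) : (forall s, mxnorm (A s) <= M) ->
  0 <= M -> rnorm (blockdiag A f) <= M * rnorm f.
Proof.
move=> AM M0.
(* A single vector is treated as a column of length 1. *)
have col1 (g : H) : l2norm (\col_(l < 1) g) = rnorm g.
  by rewrite l2normE /l2sq big_ord1 mxE sqrtr_sqr ger0_norm ?rnorm_ge0.
have st1 (g : H) s : l2norm (stack s (\col_(l < 1) g)) = l2norm (component s g).
  by rewrite !l2normE l2sq_mxcol big_ord1 mxE.
rewrite -!col1; apply: l2norm_stack_le => // s.
rewrite !st1 (component_blockdiag f s AM).
by apply: le_trans (l2norm_mul_le _ _) _; rewrite ler_wpM2r ?l2norm_ge0.
Qed.

(** A column supported on the block s0 alone. Such columns isolate one summand, both for lower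
    bounds on the norm and for extracting positivity of that summand. *)
Definition embed_col k s0 (c : 'cV[C]_(\sum_(l < k) n s0)) : 'cV[H]_k :=
  \col_l embed (submxcol c l).

Lemma stack_embed_col k s0 (c : 'cV[C]_(\sum_(l < k) n s0)) :
  stack s0 (embed_col c) = c.
Proof.
rewrite -[RHS]submxcolK; apply: eq_mxcol => l; rewrite mxE.
exact: component_embed.
Qed.

Lemma stack_embed_col_neq k s0 (c : 'cV[C]_(\sum_(l < k) n s0)) s : s != s0 ->
  stack s (embed_col c) = 0.
Proof.
move=> ss0; rewrite -[RHS]mxcol0; apply: eq_mxcol => l; rewrite mxE.
exact: component_embed_neq.
Qed.

Lemma l2sq_embed_col k s0 (c : 'cV[C]_(\sum_(l < k) n s0)) :
  l2sq (embed_col c) = l2sq c.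
Proof.
have /esym := l2sq_stack (embed_col c); rewrite (@nnsum_single _ _ _ s0).
- by rewrite stack_embed_col => -[].
- exact: l2sq_ge0.
- by move=> t ts; rewrite stack_embed_col_neq // l2sq0.
Qed.

End BlockDiagonal.

(** * Matricial norms and the direct sum of all positive complete contractions *)

Section Contractions.
Context {R : realType} {V : lmodType R[i]}.
Variable N : forall k, 'M[V]_k.+1 -> R.
Hypothesis N_norm : matricial_norm N.
Variable P : forall k, set 'M[V]_k.+1.
Local Notation C := R[i].

Lemma matricial_norm0 k : N (0 : 'M[V]_k.+1) = 0.
Proof.
have := matricial_normZ N_norm 0 (0 : 'M[V]_k.+1).
rewrite normr0 mul0r => <-; congr N.
by apply/matrixP => i j; rewrite !mxE scaler0.
Qed.

(** From the triangle inequality, 0 = N(x - x) <= N x + N(-x) = 2 N x. *)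
Lemma matricial_norm_ge0 k (x : 'M[V]_k.+1) : 0 <= N x.
Proof.
have xN : N (map_mx ( *:%R (-1)) x) = N x.
  by rewrite (matricial_normZ N_norm) normrN1 mul1r.
have := matricial_normD N_norm x (map_mx ( *:%R (-1)) x).
rewrite (_ : x + _ = 0) ?matricial_norm0 ?xN -?mulr2n ?pmulrn_lge0 //.
by apply/matrixP => i j; rewrite !mxE scaleN1r subrr.
Qed.

Lemma matricial_norm_scale k (r : R) (x : 'M[V]_k.+1) : 0 <= r ->
  N (map_mx ( *:%R r%:C) x) = r * N x.
Proof.
move=> r0; rewrite (matricial_normZ N_norm) -[complex.Re _]/(rnorm _).
by rewrite rnorm_real ger0_norm.
Qed.

Lemma matricial_norm_normalize k (x : 'M[V]_k.+1) : x != 0 ->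
  N (map_mx ( *:%R (N x)^-1%:C) x) = 1.
Proof.
move=> x0; rewrite matricial_norm_scale ?invr_ge0 ?matricial_norm_ge0 //.
rewrite mulVf //; apply: contra x0 => /eqP.
by move/(matricial_norm_eq0 N_norm)/eqP.
Qed.

Lemma amplZ n (phi : {linear V -> 'M[C]_n}) k a (x : 'M[V]_k) :
  ampl phi (map_mx ( *:%R a) x) = a *: ampl phi x.
Proof. by apply/matrixP => i j; rewrite !mxE linearZ_LR /= mxE. Qed.

Lemma ampl0 n (phi : {linear V -> 'M[C]_n}) k : ampl phi (0 : 'M[V]_k) = 0.
Proof. by apply/matrixP => i j; rewrite !mxE linear0 mxE. Qed.

(** Homogeneity replaces the suprema over unit balls by one inequality per x. The case x = 0 is
    separate, as it cannot be normalized. *)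
Lemma cbnorm_leP n (phi : {linear V -> 'M[C]_n}) :
  (cbnorm N phi <= 1)%E <-> forall k (x : 'M[V]_k.+1), mxnorm (ampl phi x) <= N x.
Proof.
split=> [h k x|h].
  have [->|x0] := eqVneq x 0.
    rewrite ampl0 matricial_norm0; apply/mxnorm_leP => u _.
    by rewrite mul0mx l2norm0.
  have N1 := matricial_norm_normalize x0.
  have Np : 0 < N x.
    rewrite lt_neqAle matricial_norm_ge0 andbT eq_sym; apply: contra x0 => /eqP.
    by move/(matricial_norm_eq0 N_norm)/eqP.
  have : (opnorm (@N k) (@mxnorm R _ _) (@ampl R V n phi k.+1) <= 1%:E)%E.
    by apply: le_trans h; apply: ereal_sup_ubound; exists k.
  move=> /opnorm_leP/(_ (map_mx ( *:%R (N x)^-1%:C) x)).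
  rewrite N1 lexx => /(_ isT) h1.
  have -> : ampl phi x = (N x)%:C *: ampl phi (map_mx ( *:%R (N x)^-1%:C) x).
    by rewrite amplZ scalerA -rmorphM /= mulfV ?gt_eqF // scale1r.
  apply: le_trans (mxnormZ _ _) _; rewrite rnorm_real ger0_norm ?(ltW Np) //.
  by rewrite ger_pMr.
apply: ge_ereal_sup => _ [k _ <-]; apply/opnorm_leP => x.
exact: le_trans (h _ _).
Qed.

(** The level of size 1 (index 0) of complete contractivity. The right-hand side does not depend on
    phi: it is the uniform bound under which the direct sum over all phi is a bounded operator. *)
Lemma mxnorm_le_const n (phi : {linear V -> 'M[C]_n}) v :
  (cbnorm N phi <= 1)%E -> mxnorm (phi v) <= N (const_mx v : 'M_1).
Proof.
move=> /cbnorm_leP/(_ 0 (const_mx v)) /mxnorm_leP h.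
apply/mxnorm_leP => u u1.
have col1 (w : 'cV[C]_n) : l2norm (\mxcol_(i < 1) w) = l2norm w.
  by rewrite !l2normE l2sq_mxcol big_ord1.
have e : ampl phi (const_mx v : 'M_1) *m (\mxcol_(i < 1) u) =
    \mxcol_(i < 1) (phi v *m u).
  by rewrite ampl_mul; apply: eq_mxcol => i; rewrite big_ord1 mxE.
by rewrite -col1 -e h // col1.
Qed.

Lemma gammap_le k (x : 'M[V]_k.+1) (r : R) :
  (gammap N P x <= r%:E)%E <->
  forall n (phi : {linear V -> 'M[C]_n.+1}), pos_contractions N P phi ->
    mxnorm (ampl phi x) <= r.
Proof.
split=> [h n phi phiS|h].
  rewrite -lee_fin; apply: le_trans h; apply: ereal_sup_ubound.
  by exists n, phi.
by apply: ge_ereal_sup => _ [n [phi [phiS ->]]]; rewrite lee_fin h.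
Qed.

(** Dependent pairs gather all sizes in one index type; [{classic _}] then supplies the choice
    structure required of an index set for sums. *)
Definition contraction_index :=
  {q : {m : nat & {linear V -> 'M[C]_m.+1}} | pos_contractions N P (tagged q)}.

Local Notation S := {classic contraction_index}.

Definition index_dim (s : S) : nat := (tag (sval (s : contraction_index))).+1.

Definition index_map (s : S) : {linear V -> 'M[C]_(index_dim s)} :=
  tagged (sval (s : contraction_index)).

Lemma index_mapP (s : S) : pos_contractions N P (index_map s).
Proof. exact: (svalP (s : contraction_index)). Qed.

Lemma index_map_le v (s : S) :
  mxnorm (index_map s v) <= N (const_mx v : 'M_1).
Proof. exact: (mxnorm_le_const _ (index_mapP s).1). Qed.

Local Notation H := (@hilbertSum R S index_dim).

Definition univ_rep (v : V) : H -> H := blockdiag (index_map^~ v).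

Lemma component_univ_rep v f s :
  component s (univ_rep v f) = index_map s v *m component s f.
Proof. exact: (component_blockdiag _ _ (index_map_le v)). Qed.

Lemma univ_rep_is_linear : linear univ_rep.
Proof.
move=> a v w; apply/funext => f; apply: componentP => s.
rewrite -[(_ + _) f]/(a *: univ_rep v f + univ_rep w f).
rewrite component_univ_rep (componentD (a *: univ_rep v f)).
rewrite (componentZ a (univ_rep v f)).
rewrite [X in _ = _ *: X + _]component_univ_rep.
by rewrite [X in _ = _ + X]component_univ_rep linearP mulmxDl scalemxAl.
Qed.

HB.instance Definition _ :=
  GRing.isLinear.Build C V (H -> H) *:%R univ_rep univ_rep_is_linear.

Definition univ_rep_linear : {linear V -> (H -> H)} := univ_rep.

Lemma univ_rep_bounded v : bounded_operators (H := hilbertSumSpace) (univ_rep v).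
Proof.
split; first exact: (blockdiag_linear (index_map_le v)).
exists (N (const_mx v : 'M_1))%:C => f.
rewrite -(rnormE (f : H)) -(rnormE (univ_rep v f : H)) -rmorphM lecR.
exact: (rnorm_blockdiag_le _ (index_map_le v) (matricial_norm_ge0 _)).
Qed.

Lemma stack_univ_rep k (x : 'M[V]_k) (u : 'cV[H]_k) s :
  stack s (mxop (H := hilbertSumSpace) (map_mx univ_rep x) u) =
  ampl (index_map s) x *m stack s u.
Proof.
rewrite ampl_mul; apply: eq_mxcol => i; rewrite mxE linear_sum.
by apply: eq_bigr => j _; rewrite mxE /= component_univ_rep.
Qed.

Lemma univ_rep_norm_le k (x : 'M[V]_k.+1) :
  (mxop_norm (H := hilbertSumSpace) (map_mx univ_rep x) <= (N x)%:E)%E.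
Proof.
apply/opnorm_leP => u u1; apply: (@le_trans _ _ (N x * l2norm u)); last first.
  by rewrite ler_piMr ?matricial_norm_ge0.
apply: l2norm_stack_le => [|s]; first exact: matricial_norm_ge0.
rewrite stack_univ_rep; apply: le_trans (l2norm_mul_le _ _) _.
rewrite ler_wpM2r ?l2norm_ge0 //.
exact: ((cbnorm_leP _).1 (index_mapP s).1).
Qed.

(** A unit vector c on which phi_k(x) is tested becomes, placed in the block of phi, a unit column
    of H^k; the image of that column has norm at least ||phi_k(x) c||. *)
Lemma univ_rep_norm_ge k (x : 'M[V]_k.+1) :
  (gammap N P x <= mxop_norm (H := hilbertSumSpace) (map_mx univ_rep x))%E.
Proof.
suff h (s : S) : ((mxnorm (ampl (index_map s) x))%:E <=
    mxop_norm (H := hilbertSumSpace) (map_mx univ_rep x))%E.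
  apply: ge_ereal_sup => _ [m [phi [phiS ->]]].
  exact: (h (exist _ (existT _ m phi) phiS)).
rewrite mxnorm_EFin; apply: ge_ereal_sup => _ [c c1 <-].
have cE : stack s (embed_col (s0 := s) c) = c := stack_embed_col _.
have -> : l2norm (ampl (index_map s) x *m c) =
    l2norm (stack s (mxop (H := hilbertSumSpace) (map_mx univ_rep x)
      (embed_col (s0 := s) c))).
  by rewrite stack_univ_rep cE.
apply: (@le_trans _ _ (l2norm (mxop (H := hilbertSumSpace) (map_mx univ_rep x)
      (embed_col (s0 := s) c)))%:E).
  by rewrite lee_fin l2norm_stack_ge.
apply: opnorm_ge; apply: le_trans c1.
by rewrite le_l2norm l2sq_embed_col.
Qed.

(** The quadratic form is the sum over s of the quadratic forms of the blocks. It is nonnegative if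
    all blocks are; conversely, columns supported on one block recover the form of that block. *)
Lemma univ_rep_positive k (x : 'M[V]_k.+1) :
  positive_operators (H := hilbertSumSpace) (map_mx univ_rep x) <-> Kcone N P x.
Proof.
have dotE (u : 'cV[H]_k.+1) :
    \sum_l inner hilbertSumSpace
      (mxop (H := hilbertSumSpace) (map_mx univ_rep x) u l 0) (u l 0) =
    csum (fun s => cdot (ampl (index_map s) x *m stack s u) (stack s u)).
  rewrite -[LHS]/(\sum_l
    hdot (mxop (H := hilbertSumSpace) (map_mx univ_rep x) u l 0) (u l 0)).
  rewrite sum_hdot_stack; congr csum; apply/funext => s.
  by rewrite stack_univ_rep.
split=> [[_ pos]|Kx].
  suff h (s : S) : psdmx (ampl (index_map s) x).
    by move=> m phi phiS; exact: (h (exist _ (existT _ m phi) phiS)).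
  apply/psdmxP => c.
  have := pos (embed_col (s0 := s) c); rewrite dotE (@csum_single _ _ _ s).
    by rewrite stack_embed_col.
  move=> t ts; rewrite stack_embed_col_neq // mulmx0.
  by rewrite /cdot big1 // => i _; rewrite mxE mul0r.
split=> [i j|u]; first by rewrite mxE; exact: univ_rep_bounded.
rewrite dotE; apply: csum_ge0 => s.
by move: (stack s u); apply/psdmxP; apply: Kx; exact: index_mapP.
Qed.

End Contractions.

(** * Orthonormal systems and compressions to finite-dimensional subspaces *)

Section Compression.
Context {R : realType} {H : hilbertSpace R}.
Local Notation C := R[i].
Local Notation "''[' u , v ]" := (inner H u v) : ring_scope.

Lemma innerC (u v : H) : '[u, v] = conjC '[v, u].
Proof. by rewrite (hermC (inner H) u v) expr0 mul1r. Qed.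

(* Zero vectors are allowed, so that Gram-Schmidt orthonormalization never has to
   discard a vector. *)
Definition orthonormal_or_zero m (e : 'I_m -> H) : Prop :=
  (forall i j, i != j -> '[e i, e j] = 0) /\
  (forall i, '[e i, e i] *: e i = e i).

(** The adjoint of [analysis e], as [inner_synthesis] records. If [e] is orthonormal up to zero
    vectors, synthesis after analysis is the orthogonal projection onto the span of [e]. *)
Definition synthesis m (e : 'I_m -> H) (c : 'cV[C]_m) : H :=
  \sum_i c i 0 *: e i.

Definition analysis m (e : 'I_m -> H) (h : H) : 'cV[C]_m := \col_i '[h, e i].

Lemma analysisE m (e : 'I_m -> H) h i : analysis e h i 0 = '[h, e i].
Proof. by rewrite mxE. Qed.

Lemma analysis_is_linear m (e : 'I_m -> H) : linear (analysis e).
Proof.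
by move=> a x y; apply/matrixP => i j; rewrite !mxE linearPl.
Qed.

HB.instance Definition _ m (e : 'I_m -> H) :=
  GRing.isLinear.Build C H 'cV[C]_m *:%R (analysis e) (analysis_is_linear e).

Lemma inner_synthesis m (e : 'I_m -> H) h c :
  '[h, synthesis e c] = cdot (analysis e h) c.
Proof.
rewrite linear_sumr; apply: eq_bigr => i _.
by rewrite linearZr_LR /= mxE mulrC.
Qed.

Section OrthonormalOrZero.
Variables (m : nat) (e : 'I_m -> H).
Hypothesis e_on : orthonormal_or_zero e.

Lemma analysis_synthesis c i :
  analysis e (synthesis e c) i 0 = c i 0 * '[e i, e i].
Proof.
rewrite mxE linear_sumlz (bigD1 i) //= linearZl_LR big1 ?addr0 // => j ji.
by rewrite linearZl_LR /= e_on.1 ?mulr0.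
Qed.

(** The condition '[e i, e i] *: e i = e i makes '[e i, e i] idempotent, hence 0 or 1. *)
Lemma inner_on_le1 i : '[e i, e i] <= 1.
Proof.
have h : '[e i, e i] * '[e i, e i] = '[e i, e i].
  by rewrite -[LHS](linearZl_LR (inner H)) e_on.2.
have [->|n0] := eqVneq '[e i, e i] 0; first exact: ler01.
by rewrite (mulfI n0 (etrans h (esym (mulr1 _)))).
Qed.

Lemma rnorm_synthesis_le c : rnorm (synthesis e c) ^+ 2 <= l2sq c.
Proof.
rewrite -lecR rmorphXn /= rnormE -inner_norm inner_synthesis.
rewrite /l2sq rmorph_sum; apply: ler_sum => i _.
rewrite analysis_synthesis /= rnorm_sqr mulrAC ler_piMr ?inner_on_le1 //.
exact: mul_conjC_ge0.
Qed.

(** With p the projection of h and b the squared norm of its coefficients, <h, p> = b and <p, p> <=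
    b, so 0 <= ||h - p||^2 <= ||h||^2 - b. *)
Lemma Bessel h : l2sq (analysis e h) <= rnorm h ^+ 2.
Proof.
set b := l2sq _; set p := synthesis e (analysis e h).
have hp : '[h, p] = b%:C by rewrite inner_synthesis cdotuu.
have pp : '[p, p] <= b%:C.
  by rewrite inner_norm -rnormE -rmorphXn lecR rnorm_synthesis_le.
have := dnorm_ge0 (inner H) (h - p).
rewrite dnormB hp conjCE conjc_real => h0.
rewrite -lecR rmorphXn /= rnormE -inner_norm -subr_ge0.
apply: le_trans h0 _; rewrite -subr_ge0.
rewrite (_ : _ - _ = b%:C - '[p, p]) ?subr_ge0 //; ring.
Qed.

Lemma Parseval h : h = synthesis e (analysis e h) ->
  l2sq (analysis e h) = rnorm h ^+ 2.
Proof.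
move=> hE; apply: (@complexI R); rewrite rmorphXn /= rnormE -inner_norm.
by rewrite {3}hE inner_synthesis cdotuu.
Qed.

End OrthonormalOrZero.

Lemma gram_schmidt (xs : seq H) : exists m (e : 'I_m.+1 -> H),
  orthonormal_or_zero e /\
  forall x, x \in xs -> x = synthesis e (analysis e x).
Proof.
elim: xs => [|y xs [m [e [e_on eP]]]].
  (* The empty list gets one zero vector, because matrix sizes start at 1. *)
  exists 0%N, (fun=> 0); split=> //; split=> [i j _|i].
    by rewrite linear0r.
  by rewrite scaler0.
pose r := y - synthesis e (analysis e y).
(* If y already lies in the span, then r = 0 and e1 is a zero vector, which [orthonormal_or_zero]
   permits. *)
pose e1 := (`|r|)^-1 *: r.
have re i : '[r, e i] = 0.
  rewrite -analysisE /r linearB /= mxE [X in _ + X]mxE analysis_synthesis //.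
  rewrite !analysisE -{1}(e_on.2 i) linearZr_LR /= -innerC.
  by rewrite mulrC subrr.
have e1e i : '[e1, e i] = 0 by rewrite linearZl_LR /= re mulr0.
have ee1 i : '[e i, e1] = 0 by rewrite innerC e1e rmorph0.
have se1 c : '[synthesis e c, e1] = 0.
  by rewrite linear_sumlz big1 // => i _; rewrite linearZl_LR /= ee1 mulr0.
have e1n : '[e1, e1] *: e1 = e1.
  have [r0|r0] := eqVneq r 0; first by rewrite /e1 r0 !scaler0.
  rewrite dnormZ inner_norm normfV normr_id -exprMn mulVf ?normr_eq0 //.
  by rewrite expr1n scale1r.
have e1r : '[r, e1] *: e1 = r.
  have [r0|r0] := eqVneq r 0; first by rewrite /e1 r0 !scaler0.
  rewrite linearZr_LR /= inner_norm geC0_conj ?invr_ge0 // scalerA expr2.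
  by rewrite mulKf ?normr_eq0 // mulfV ?normr_eq0 // scale1r.
pose e' (i : 'I_m.+2) := if unlift ord_max i is Some j then e j else e1.
have e'l j : e' (lift ord_max j) = e j by rewrite /e' liftK.
have e'm : e' ord_max = e1 by rewrite /e' unlift_none.
have e'S x : synthesis e' (analysis e' x) =
    synthesis e (analysis e x) + '[x, e1] *: e1.
  rewrite /synthesis big_ord_recr /= mxE e'm; congr (_ + _).
  apply: eq_bigr => j _; rewrite !mxE.
  rewrite (_ : widen_ord _ j = lift ord_max j) ?e'l //.
  by apply: val_inj; rewrite /= /bump leqNgt ltn_ord.
exists m.+1, e'; split.
  split=> [i j|i]; case: (unliftP ord_max i) => [k|] ->; last 2 first.
  - by rewrite e'l e_on.2.
  - by rewrite e'm.
  1,2: case: (unliftP ord_max j) => [l|] ->; rewrite ?e'l ?e'm ?eqxx //.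
  by rewrite (inj_eq lift_inj); exact: e_on.1.
move=> x; rewrite inE e'S => /orP[/eqP ->|/eP xE].
  have -> : '[y, e1] = '[r, e1] by rewrite /r linearBl /= se1 subr0.
  by rewrite e1r addrC subrK.
by rewrite {3}xE se1 scale0r addr0.
Qed.

Definition synthesis_col m (e : 'I_m -> H) k (c : 'cV[C]_(\sum_(l < k) m)) :
  'cV[H]_k := \col_l synthesis e (submxcol c l).

Definition analysis_col m (e : 'I_m -> H) k (h : 'cV[H]_k) :
  'cV[C]_(\sum_(l < k) m) := \mxcol_l analysis e (h l 0).

Lemma l2norm_synthesis_col_le m (e : 'I_m -> H) k (c : 'cV[C]_(\sum_(l < k) m)) :
  orthonormal_or_zero e -> l2norm (synthesis_col e c) <= l2norm c.
Proof.
move=> e_on; rewrite le_l2norm -{2}(submxcolK c) l2sq_mxcol.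
by apply: ler_sum => l _; rewrite mxE rnorm_synthesis_le.
Qed.

Lemma l2norm_analysis_col_le m (e : 'I_m -> H) k (h : 'cV[H]_k) :
  orthonormal_or_zero e -> l2norm (analysis_col e h) <= l2norm h.
Proof.
move=> e_on; rewrite le_l2norm l2sq_mxcol.
by apply: ler_sum => l _; exact: Bessel.
Qed.

Lemma l2norm_analysis_col m (e : 'I_m -> H) k (h : 'cV[H]_k) :
  orthonormal_or_zero e ->
  (forall l, h l 0 = synthesis e (analysis e (h l 0))) ->
  l2norm (analysis_col e h) = l2norm h.
Proof.
move=> e_on hE; rewrite !l2normE l2sq_mxcol; congr Num.sqrt.
by apply: eq_bigr => l _; exact: Parseval.
Qed.

Lemma synthesis_analysis_col m (e : 'I_m -> H) k (h : 'cV[H]_k) :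
  (forall l, h l 0 = synthesis e (analysis e (h l 0))) ->
  synthesis_col e (analysis_col e h) = h.
Proof. by move=> hE; apply/matrixP => l j; rewrite ord1 mxE mxcolK -hE. Qed.

Lemma sum_inner_synthesis_col m (e : 'I_m -> H) k (h : 'cV[H]_k)
    (c : 'cV[C]_(\sum_(l < k) m)) :
  \sum_l '[h l 0, synthesis_col e c l 0] = cdot (analysis_col e h) c.
Proof.
rewrite -{2}(submxcolK c) cdot_mxcol; apply: eq_bigr => l _.
by rewrite mxE inner_synthesis.
Qed.

Section CompressedMap.
Variables (V : lmodType C) (Phi : {linear V -> (H -> H)}).
Hypothesis Phi_bounded : forall v, bounded_operators (Phi v).
Variables (m : nat) (e : 'I_m -> H).

Definition compression (v : V) : 'M[C]_m := \matrix_(i, j) '[Phi v (e j), e i].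

Lemma compression_is_linear : linear compression.
Proof.
move=> a v w; apply/matrixP => i j; rewrite !mxE linearP.
by rewrite -[(_ + _) (e j)]/(a *: Phi v (e j) + Phi w (e j)) linearPl.
Qed.

HB.instance Definition _ :=
  GRing.isLinear.Build C V 'M[C]_m *:%R compression compression_is_linear.

(** With E = synthesis e, the compression is E* Phi(v) E. *)
Lemma compression_mul v c :
  compression v *m c = analysis e (Phi v (synthesis e c)).
Proof.
have [lin _] := Phi_bounded v.
(* [Phi v] is a bare function whose linearity is only a part of [bounded_operators]; packing it
   makes the lemmas on linear maps applicable. *)
pose T : {linear H -> H} := HB.pack (Phi v : H -> H)
  (GRing.isLinear.Build C H H *:%R (Phi v) lin).
rewrite -[Phi v (synthesis e c)]/(T (synthesis e c)) linear_sum.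
apply/matrixP => i k; rewrite ord1 !mxE linear_sumlz; apply: eq_bigr => j _.
by rewrite mxE linearZ /= linearZl_LR /= mulrC.
Qed.

Lemma ampl_compression k (x : 'M[V]_k) c :
  ampl compression x *m c =
  analysis_col e (mxop (map_mx Phi x) (synthesis_col e c)).
Proof.
rewrite -{1}(submxcolK c) ampl_mul; apply: eq_mxcol => i; rewrite mxE linear_sum.
by apply: eq_bigr => j _; rewrite !mxE compression_mul.
Qed.

End CompressedMap.

End Compression.

(** * Norms and positivity in a concrete representation, read from its compressions *)

Section ConcreteSystems.
Context {R : realType} {V : lmodType R[i]}.
Variable N : forall k, 'M[V]_k.+1 -> R.
Hypothesis N_norm : matricial_norm N.
Variable P : forall k, set 'M[V]_k.+1.
Local Notation C := R[i].
Variables (H : hilbertSpace R) (Phi : {linear V -> (H -> H)}).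
Hypothesis Phi_bounded : forall v, bounded_operators (Phi v).
Hypothesis Phi_isometric : forall k (x : 'M[V]_k.+1),
  mxop_norm (map_mx Phi x) = (N x)%:E.
Hypothesis Phi_positive : forall k (x : 'M[V]_k.+1), P x ->
  positive_operators (map_mx Phi x).

(** Synthesis and analysis are both contractive on columns, which bounds the norms at every level.
    Positivity is inherited since <E* T E c, c> = <T E c, E c>. *)
Lemma compression_pos_contraction m (e : 'I_m.+1 -> H) :
  orthonormal_or_zero e -> pos_contractions N P (compression Phi e).
Proof.
move=> e_on; split.
  apply/(cbnorm_leP N_norm) => k x; apply/mxnorm_leP => c c1.
  rewrite ampl_compression //; apply: le_trans (l2norm_analysis_col_le _ e_on) _.
  have : (mxop_norm (map_mx Phi x) <= (N x)%:E)%E by rewrite Phi_isometric.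
  move=> /opnorm_leP; apply.
  exact: le_trans (l2norm_synthesis_col_le _ e_on) c1.
move=> k x /Phi_positive[_ pos]; apply/psdmxP => c.
by rewrite ampl_compression // -sum_inner_synthesis_col.
Qed.

Lemma isometric_le_gammap k (x : 'M[V]_k.+1) : ((N x)%:E <= gammap N P x)%E.
Proof.
rewrite -Phi_isometric; apply: ge_ereal_sup => _ [u u1 <-].
set h := mxop _ u.
(* The span must contain the coordinates of u, so that synthesis recovers u, and those of its image
   h, so that analysis preserves the norm of h. *)
have [m [e [e_on eP]]] := gram_schmidt ([seq u l 0 | l <- enum 'I_k.+1] ++
  [seq h l 0 | l <- enum 'I_k.+1]).
have uE l : u l 0 = synthesis e (analysis e (u l 0)).
  by apply: eP; rewrite mem_cat (map_f (fun l => u l 0)) ?mem_enum.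
have hE l : h l 0 = synthesis e (analysis e (h l 0)).
  by apply: eP; rewrite mem_cat (map_f (fun l => h l 0)) ?mem_enum ?orbT.
apply: (@le_trans _ _ (mxnorm (ampl (compression Phi e) x))%:E); last first.
  apply: ereal_sup_ubound; exists m, (compression Phi e); split=> //.
  exact: compression_pos_contraction.
rewrite lee_fin -(l2norm_analysis_col e_on hE).
have -> : analysis_col e h = ampl (compression Phi e) x *m analysis_col e u.
  by rewrite ampl_compression // synthesis_analysis_col.
apply: ((mxnorm_leP _ _).1 (lexx _)).
exact: le_trans (l2norm_analysis_col_le _ e_on) u1.
Qed.

Lemma Kcone_positive k (x : 'M[V]_k.+1) : Kcone N P x ->
  positive_operators (map_mx Phi x).
Proof.
move=> Kx; split=> [i j|u]; first by rewrite mxE; exact: Phi_bounded.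
(* Here the coordinates of u suffice: <Phi_k(x) u, u> depends only on the projection of Phi_k(x) u
   onto their span. *)
have [m [e [e_on eP]]] := gram_schmidt [seq u l 0 | l <- enum 'I_k.+1].
have uE l : u l 0 = synthesis e (analysis e (u l 0)).
  by apply: eP; rewrite (map_f (fun l => u l 0)) ?mem_enum.
have := (psdmxP _).1 (Kx _ _ (compression_pos_contraction e_on)) (analysis_col e u).
by rewrite ampl_compression // -sum_inner_synthesis_col synthesis_analysis_col.
Qed.

(** Needed to return from an equality of images under Phi_n to an equality in M_n(V), when K_n is
    shown to lie in the given cone. *)
Lemma isometric_inj k : injective (map_mx Phi : 'M[V]_k.+1 -> 'M[H -> H]_k.+1).
Proof.
move=> x y xy; apply/eqP; rewrite -subr_eq0; apply/eqP.
apply: (matricial_norm_eq0 N_norm); apply: EFin_inj.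
rewrite -Phi_isometric map_mxB xy subrr.
rewrite -[X in mxop_norm X](map_mx0 Phi) Phi_isometric.
by rewrite matricial_norm0.
Qed.

End ConcreteSystems.

Theorem theoremA2 (R : realType) (V : lmodType R[i])
    (V_nonzero : exists v : V, v != 0)
    (N : forall k, 'M[V]_k.+1 -> R) (N_norm : matricial_norm N)
    (P : forall k, set 'M[V]_k.+1) (P_cone : forall k, is_cone (P k)) :
  (exists (H : hilbertSpace R) (Phi : {linear V -> (H -> H)}),
      [/\ forall v, bounded_operators (Phi v),
          forall k (x : 'M[V]_k.+1), mxop_norm (map_mx Phi x) = (N k x)%:E &
          forall n, map_mx Phi @` P n =
            range (map_mx Phi : 'M[V]_n.+1 -> 'M[H -> H]_n.+1)
              `&` positive_operators (H := H) (n := n.+1)])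
  <-> (ncbp N P = 1%:E /\ forall n, P n = Kcone N P (n := n)).
Proof.
have gamma_le k (x : 'M[V]_k.+1) : (gammap N P x <= (N k x)%:E)%E.
  by apply/gammap_le => n phi [/(cbnorm_leP N_norm)].
split=> [[H [Phi [Phi_bd Phi_iso Phi_pos]]]|[ncb1 PK]].
  have PhiP k (x : 'M[V]_k.+1) : P k x -> positive_operators (map_mx Phi x).
    move=> Px; have : (map_mx Phi @` P k) (map_mx Phi x) by exists x.
    by rewrite Phi_pos => -[].
  split.
    have [v v0] := V_nonzero.
    have c0 : const_mx v != 0 :> 'M[V]_1.
      by apply: contra v0 => /eqP/matrixP/(_ 0 0); rewrite !mxE => ->.
    apply/eqP; rewrite eq_le; apply/andP; split.
      (* A nonzero v yields a matrix of norm one at the first level; without one, the infimum would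
         be +oo. *)
      pose y := map_mx ( *:%R (N 0 (const_mx v))^-1%:C) (const_mx v : 'M[V]_1).
      have y1 : N 0 y = 1 by exact: matricial_norm_normalize.
      apply: (@le_trans _ _ (gammap N P y)); last by rewrite -y1.
      by apply: ereal_inf_lbound; exists 0%N, y.
    apply: le_ereal_inf_tmp => _ [k [x [x1 ->]]]; rewrite -x1.
    exact: (isometric_le_gammap N_norm Phi_bd Phi_iso PhiP).
  move=> n; apply/seteqP; split=> [x Px k phi [_ phiP]|x Kx]; first exact: phiP.
  have : (map_mx Phi @` P n) (map_mx Phi x).
    rewrite Phi_pos; split; first by exists x.
    exact: (Kcone_positive N_norm Phi_bd Phi_iso PhiP).
  by move=> [y Py /(isometric_inj N_norm Phi_iso) <-].
(* Normalizing x turns n^+_cb = 1 into ||x|| <= gamma^+(x). The form with a real bound M avoids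
   arithmetic with the extended real gamma^+(x). *)
have N_le_gamma k (x : 'M[V]_k.+1) (M : R) : 0 <= M ->
    (gammap N P x <= M%:E)%E -> N k x <= M.
  move=> M0 /gammap_le h; have [->|x0] := eqVneq x 0.
    by rewrite matricial_norm0.
  have N1 := matricial_norm_normalize N_norm x0.
  have Np : 0 < N k x.
    rewrite lt_neqAle (matricial_norm_ge0 N_norm) andbT eq_sym.
    by apply: contra x0 => /eqP /(matricial_norm_eq0 N_norm) ->.
  have : (1%:E <= ((N k x)^-1 * M)%:E)%E.
    pose y := map_mx ( *:%R (N k x)^-1%:C) x.
    rewrite -ncb1; apply: (@le_trans _ _ (gammap N P y)).
      by apply: ereal_inf_lbound; exists k, y.
    apply/gammap_le => n phi phiS; rewrite amplZ; apply: le_trans (mxnormZ _ _) _.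
    rewrite rnorm_real ger0_norm ?invr_ge0 ?(ltW Np) //.
    by rewrite ler_wpM2l ?invr_ge0 ?(ltW Np) // h.
  by rewrite lee_fin mulrC ler_pdivlMr // mul1r.
exists hilbertSumSpace, (univ_rep_linear N_norm P); split.
- exact: (univ_rep_bounded N_norm).
- move=> k x; apply/eqP; rewrite eq_le (univ_rep_norm_le N_norm) /=.
  have := univ_rep_norm_ge N_norm P x; have := univ_rep_norm_le N_norm P x.
  have : (0%:E <= mxop_norm (H := hilbertSumSpace)
      (map_mx (univ_rep_linear N_norm P) x))%E.
    apply: le_trans (opnorm_ge _ _ (u := 0) _); last by rewrite l2norm0 ler01.
    by rewrite lee_fin l2norm_ge0.
  (* The operator norm is finite, lying between 0 and N x. As a real number M it bounds gamma^+(x),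
     hence also N x. *)
  case: (mxop_norm _) => [M M0 _ /N_le_gamma|//|//].
  by rewrite !lee_fin in M0 *; apply.
- move=> n; apply/seteqP; split=> [_ [x Px <-]|_ [[x _ <-] xpos]].
    split; first by exists x.
    by apply/(univ_rep_positive N_norm); rewrite -PK.
  exists x => //; rewrite PK.
  by apply/(univ_rep_positive N_norm).
Qed.
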